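(* Let $A, B \in \Omega_n$. (i) The Lempert function $l_{\Omega_n}:\Omega_n\times\Omega_n\to[0,1)$ is continuous at $(A,B)$ if and only if $l_{\Omega_n}(A,B) = l_{\mathbb{G}_n}(\sigma(A),\sigma(B))$. (ii) If $B$ is cyclic, and the function $l_{\Omega_n}(\cdot,B)$ is continuous at $A$, then $l_{\Omega_n}(A,B) = l_{\mathbb{G}_n}(\sigma(A),\sigma(B))$.
   Context: $\mathbb D$ is the open unit disk in $\mathbb C$. $\mathcal M_n$ is the set of all $n\times n$ complex matrices; $r(A)$ is the spectral radius of $A$. The spectral ball is $\Omega_n=\{A\in\mathcal M_n: r(A)<1\}$. The map $\sigma=(\sigma_1,\dots,\sigma_n):\mathcal M_n\to\mathbb C^n$ is defined by $\det(tI-A)=t^n+\sum_{j=1}^n(-1)^j\sigma_j(A)t^{n-j}$. The symmetrized polydisk is $\mathbb G_n:=\sigma(\Omega_n)$, a bounded domain in $\mathbb C^n$. A matrix $A\in\mathcal M_n$ is cyclic (non-derogatory) if it admits a cyclic vector, i.e. there is $v\in\mathbb C^n$ such that $v, Av,\dots,A^{n-1}v$ span $\mathbb C^n$. For a domain $D\subset\mathbb C^m$ and $z,w\in D$, the Lempert function is $$l_D(z,w):=\inf\{|\alpha|:\alpha\in\mathbb D \text{ and } \exists\,\varphi\in\mathcal O(\mathbb D,D):\varphi(0)=z,\ \varphi(\alpha)=w\},$$ where $\mathcal O(\mathbb D,D)$ is the set of holomorphic maps from $\mathbb D$ to $D$. *)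

(* Defs.v *)
From HB Require Import structures.
From mathcomp Require Import all_boot all_order all_algebra.
From mathcomp.real_closed Require Import complex.
From mathcomp Require Import all_classical all_reals all_analysis.

Set Implicit Arguments.
Unset Strict Implicit.
Unset Printing Implicit Defensive.

Import Order.TTheory GRing.Theory Num.Theory.
Import numFieldNormedType.Exports.

Local Open Scope classical_set_scope.
Local Open Scope ring_scope.

(* The complex numbers, packaged as a numFieldType: R[i] itself carries no
   canonical topology, whereas the sort of a numFieldType (and hence the
   matrices over it) gets one from numFieldNormedType.Exports. *)
Definition CC (R : realType) : numFieldType := R[i].

(* The modulus with values in R; the norm `|z| of CC R has values in CC R. *)
Definition cabs (R : realType) (z : CC R) : R := Normc.normc z.

Definition unit_disk (R : realType) : set (CC R) := [set z | cabs z < 1].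

(* The set O(disk, D). Only the values of phi on the disk matter; the disk is
   open, so [derivable phi z 1] is complex differentiability at z. *)
Definition holo_disk (R : realType) (V : normedModType (CC R)) (D : set V) :
    set (CC R -> V) :=
  [set phi | forall z, unit_disk z -> D (phi z) /\ derivable phi z 1].

(* The infimum is that of a nonempty set when D is a domain and z, w lie in D;
   recall that [inf] is 0 on the empty set. *)
Definition lempert (R : realType) (V : normedModType (CC R)) (D : set V)
    (z w : V) : R :=
  inf [set cabs a | a in [set a : CC R | unit_disk a /\
    exists phi, [/\ holo_disk D phi, phi 0 = z & phi a = w]]].

Definition spectral_radius (R : realType) (n : nat) (A : 'M[CC R]_n) : R :=
  sup [set cabs a | a in [set a : CC R | eigenvalue A a]].

Definition spectral_ball (R : realType) (n : nat) : set 'M[CC R]_n :=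
  [set A | spectral_radius A < 1].

(* The j-th entry (j counted from 0) is sigma_(j+1), where
   \det (t - A) = t ^+ n + \sum_(1 <= k <= n) (-1) ^+ k * sigma_k * t ^+ (n - k). *)
Definition sigma (R : realType) (n : nat) (A : 'M[CC R]_n) : 'rV[CC R]_n :=
  \row_(j < n) ((-1) ^+ j.+1 * (char_poly A)`_(n - j.+1)).

Definition symmetrized_polydisk (R : realType) (n : nat) : set 'rV[CC R]_n :=
  @sigma R n @` @spectral_ball R n.

(* v, A v, ..., A ^+ n.-1 v are the (transposed) rows of the matrix below. *)
Definition cyclic_mx (R : realType) (n : nat) (A : 'M[CC R]_n) : Prop :=
  exists v : 'cV[CC R]_n, row_full (\matrix_(j < n) (A ^+ j *m v)^T).

(* Continuity at x of the restriction of f to S, for x in S. *)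
Definition continuous_on_at (T U : topologicalType) (S : set T) (f : T -> U)
    (x : T) : Prop :=
  f @ within S (nbhs x) --> f x.

Arguments spectral_ball : clear implicits.
Arguments symmetrized_polydisk : clear implicits.

(* Main.v *)
(** The map [sigma] sends the spectral ball onto the symmetrized polydisk and
    does not increase Lempert functions.  For cyclic [A] and [B] it preserves
    them: a disk [phi] in the polydisk lifts to [S (companion phi)^T S^-1], where
    [S] is a holomorphic path of invertible matrices with prescribed values at
    the two nodes.  Cyclic matrices are dense, so the theorem follows from two
    facts: the Lempert function of the spectral ball is upper semicontinuous,
    and that of the symmetrized polydisk is continuous.

    Both are proved by moving the end points of a shrunken disk [phi (r w)] with
    a small affine correction, which requires [phi (r w)] to stay at a positive
    distance from the boundary.  For the polydisk this distance is uniform in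
    [phi]: for [|t| = 1] the logarithmic derivative
    [t p'(t) / p(t) = \sum 1 / (1 - lambda_i / t)] of the polynomial [p] with
    roots [lambda_i] has positive real part, and Harnack's inequality controls
    it along the disk.  Harnack's inequality is derived from a Cauchy estimate,
    which needs Goursat's theorem only for midpoint sums along dyadic
    subdivisions of squares, hence no integral. *)
Require Import Defs.
From mathcomp Require Import all_boot all_order all_algebra perm.
From mathcomp.real_closed Require Import complex.
From mathcomp Require Import all_classical all_reals all_analysis.
From mathcomp Require Import zify ring lra.
Import numFieldNormedType.Exports.
Set Implicit Arguments.
Unset Strict Implicit.
Unset Printing Implicit Defensive.
Import Order.TTheory GRing.Theory Num.Theory.

Local Open Scope classical_set_scope.
Local Open Scope ring_scope.

(** * Complex modulus and derivability *)
Section Modulus.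
Variable R : realType.
Implicit Types (z w : CC R) (x y : R).

(** The margin of a disk is what separates the two domains. In the spectral ball it comes from
    compactness of a smaller closed disk and depends on [phi]; this suffices for upper
    semicontinuity, where one disk is fixed and only its end points move. Lower semicontinuity moves
    the end points of arbitrary disks to a fixed pair, so the margin must be uniform over these
    disks, and so must a lower bound on [|alpha|], because an affine correction that moves the end
    points by [d] grows like [d / |alpha|]. When the two end points of the limit pair differ, a weak
    Schwarz lemma bounds [|alpha|] below; when they coincide, constant disks are used instead. The
    constants in the function theory are crude: only their independence of the function matters, so
    a Schwarz lemma with a square root in place of the sharp linear bound is enough. *)

Definition cre z : R := complex.Re z.
Definition cim z : R := complex.Im z.
Definition rc x : CC R := x%:C%C.
Definition ci : CC R := 'i%C.

Lemma cabsE z : cabs z = Num.sqrt (cre z ^+ 2 + cim z ^+ 2).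
Proof. by case: z. Qed.

Lemma normCE z : `|z| = rc (cabs z).
Proof. by case: z. Qed.

Lemma cabs0 : cabs (0 : CC R) = 0.
Proof. exact: (@Normc.normc0 R). Qed.
Lemma cabs1 : cabs (1 : CC R) = 1.
Proof. exact: (@Normc.normc1 R). Qed.
Lemma cabsM z w : cabs (z * w) = cabs z * cabs w.
Proof. exact: Normc.normcM. Qed.
Lemma cabsV z : cabs z^-1 = (cabs z)^-1.
Proof. exact: Normc.normcV. Qed.
Lemma cabsN z : cabs (- z) = cabs z.
Proof. exact: normcN. Qed.
Lemma cabsB z w : cabs (z - w) = cabs (w - z).
Proof. by rewrite -cabsN opprB. Qed.
Lemma cabs_ge0 z : 0 <= cabs z.
Proof. by rewrite cabsE sqrtr_ge0. Qed.
Lemma cabsD z w : cabs (z + w) <= cabs z + cabs w.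
Proof. exact: le_normcD. Qed.
Lemma cabs_eq0 z : (cabs z == 0) = (z == 0).
Proof.
by apply/eqP/eqP => [/Normc.eq0_normc //|->]; exact: cabs0.
Qed.
Lemma cabs_gt0 z : (0 < cabs z) = (z != 0).
Proof. by rewrite lt_neqAle cabs_ge0 andbT eq_sym cabs_eq0. Qed.
Lemma cabsX z n : cabs (z ^+ n) = cabs z ^+ n.
Proof. by elim: n => [|n IH]; rewrite ?expr0 ?cabs1 // !exprS cabsM IH. Qed.
Lemma cabs_sum I (r : seq I) (F : I -> CC R) :
  cabs (\sum_(i <- r) F i) <= \sum_(i <- r) cabs (F i).
Proof.
elim/big_rec2 : _ => [|i x z _ le_zx]; first by rewrite cabs0.
by rewrite (le_trans (cabsD _ _)) // lerD2l.
Qed.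
Lemma cabs_prod I (r : seq I) (F : I -> CC R) :
  cabs (\prod_(i <- r) F i) = \prod_(i <- r) cabs (F i).
Proof.
elim/big_rec2 : _ => [|i x z _ le_zx]; first by rewrite cabs1.
by rewrite cabsM le_zx.
Qed.

Lemma creD z w : cre (z + w) = cre z + cre w. Proof. by case: z; case: w. Qed.
Lemma cimD z w : cim (z + w) = cim z + cim w. Proof. by case: z; case: w. Qed.
Lemma creN z : cre (- z) = - cre z. Proof. by case: z. Qed.
Lemma cimN z : cim (- z) = - cim z. Proof. by case: z. Qed.
Lemma creM z w : cre (z * w) = cre z * cre w - cim z * cim w.
Proof. by case: z; case: w. Qed.
Lemma cimM z w : cim (z * w) = cre z * cim w + cim z * cre w.
Proof. by case: z; case: w. Qed.
Lemma cre_rc x : cre (rc x) = x. Proof. by []. Qed.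
Lemma cim_rc x : cim (rc x) = 0. Proof. by []. Qed.
Lemma cre_ci : cre ci = 0. Proof. by []. Qed.
Lemma cim_ci : cim ci = 1. Proof. by []. Qed.
Lemma creV z : cre z^-1 = cre z / (cabs z) ^+ 2.
Proof.
rewrite cabsE sqr_sqrtr ?addr_ge0 ?sqr_ge0 //.
by case: z.
Qed.
Lemma cimV z : cim z^-1 = - cim z / (cabs z) ^+ 2.
Proof.
rewrite cabsE sqr_sqrtr ?addr_ge0 ?sqr_ge0 //.
by case: z => a b; rewrite mulNr.
Qed.
Lemma sqr_cabs z : cabs z ^+ 2 = cre z ^+ 2 + cim z ^+ 2.
Proof. by rewrite cabsE sqr_sqrtr ?addr_ge0 ?sqr_ge0. Qed.

Lemma ccP z w : cre z = cre w -> cim z = cim w -> z = w.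
Proof. by case: z; case: w => a b c d /= -> ->. Qed.

Definition cE := (creD, cimD, creN, cimN, creM, cimM, cre_rc, cim_rc, cre_ci, cim_ci).

Lemma rcD x y : rc (x + y) = rc x + rc y.
Proof. by apply: ccP; rewrite !cE ?addr0. Qed.
Lemma rcM x y : rc (x * y) = rc x * rc y.
Proof. by apply: ccP; rewrite !cE ?mulr0 ?mul0r ?subr0 ?addr0. Qed.
Lemma rcN x : rc (- x) = - rc x.
Proof. by apply: ccP; rewrite !cE ?oppr0. Qed.
Lemma rcV x : rc x^-1 = (rc x)^-1.
Proof. exact: (fmorphV (real_complex R)). Qed.
Lemma cabs_rc x : cabs (rc x) = `|x|.
Proof. by rewrite cabsE /= expr0n addr0 sqrtr_sqr. Qed.
Lemma cabs_ci : cabs ci = 1.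
Proof. by rewrite cabsE /= expr0n add0r expr1n sqrtr1. Qed.
Lemma ci2 : ci * ci = -1.
Proof. by rewrite -expr2; exact: (@sqr_i R). Qed.

Lemma cre_le_cabs z : cre z <= cabs z.
Proof.
rewrite (le_trans (ler_norm _)) // -(@ler_sqr _ `|cre z|) ?nnegrE ?cabs_ge0 //.
by rewrite sqr_cabs real_normK ?num_real // lerDl sqr_ge0.
Qed.
Lemma cim_le_cabs z : cim z <= cabs z.
Proof.
rewrite (le_trans (ler_norm _)) // -(@ler_sqr _ `|cim z|) ?nnegrE ?cabs_ge0 //.
by rewrite sqr_cabs real_normK ?num_real // lerDr sqr_ge0.
Qed.

Lemma cabs_ltE z x : (cabs z < x) = (`|z| < rc x).
Proof. by rewrite normCE; exact/esym/ltcR. Qed.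

Lemma gt0_rc (e : CC R) : 0 < e -> e = rc (cre e) /\ 0 < cre e.
Proof.
move=> e0; have := e0; rewrite ltcE => /andP[/eqP/= im0 re0]; split => //.
by apply: ccP.
Qed.

(** Balls of the topology have radii in [CC R]. This lemma and the next trade them for real radii
    and the real modulus, after which all epsilon arguments take place in [R]. *)
Lemma nbhs_CCP z (P : set (CC R)) :
  nbhs z P <-> exists2 d : R, 0 < d & forall w, cabs (w - z) < d -> P w.
Proof.
split=> [/nbhs_ballP[e /= /gt0_rc[ee e0] zP]|[d d0 zP]].
  exists (cre e) => // w zw; apply: zP; rewrite /ball /= ee.
  by rewrite -cabs_ltE cabsB.
apply/nbhs_ballP; exists (rc d) => /=; first by rewrite ltcR.
by move=> w; rewrite /ball /= -cabs_ltE cabsB; exact: zP.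
Qed.

Lemma nbhs_mxP m n (A : 'M[CC R]_(m, n)) (P : set 'M[CC R]_(m, n)) :
  nbhs A P <-> exists2 d : R, 0 < d &
    forall X : 'M[CC R]_(m, n), (forall i j, cabs (X i j - A i j) < d) -> P X.
Proof.
split=> [/nbhs_ballP[e /= e0 AP]|[d d0 AP]].
  have [ee re0] := gt0_rc e0.
  exists (cre e) => // X AX; apply: AP; split => // i j.
  by rewrite ee /ball /= -cabs_ltE cabsB.
apply/nbhs_ballP; exists (rc d) => /=; first by rewrite ltcR.
move=> X [_ AX]; apply: AP => i j.
by have := AX i j; rewrite /ball /= -cabs_ltE cabsB.
Qed.

(** Reduces holomorphy of matrix-valued maps to scalar functions, where the ring operations are
    available. *)
Lemma derivable_mxCP m n (M : CC R -> 'M[CC R]_(m, n)) z :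
  derivable M z 1 <-> forall i j, derivable (fun w => M w i j) z 1.
Proof.
split=> [/derivable1_diffP dM i j|dM].
  apply/derivable1_diffP.
  exact: (differentiable_comp dM (differentiable_coord _ i j)).
apply/cvg_ex => /=.
exists (\matrix_(i < m, j < n) sval (cid ((cvg_ex _).1 (dM i j)))).
move=> P /nbhs_mxP[d d0 dP].
rewrite /nbhs /= /nbhs /=.
have : \forall h \near (0 : CC R)^', forall i, forall j,
    cabs ((h^-1 *: (M (h *: 1 + z) i j - M z i j))
          - sval (cid ((cvg_ex _).1 (dM i j)))) < d.
  apply: filter_forall => i; apply: filter_forall => j.
  have := svalP (cid ((cvg_ex _).1 (dM i j))).
  move=> /cvgrPdist_lt/(_ (rc d)); rewrite ltcR => /(_ d0).
  by apply: filterS => h; rewrite -cabs_ltE cabsB.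
by apply: filterS => h hd; apply: dP => i j; have := hd i j; rewrite !mxE.
Qed.

(** The division-free form of the difference quotient, valid at [w = z] as well; [derivable_eps] is
    the converse. *)
Lemma derivableE (f : CC R -> CC R) z :
  derivable f z 1 -> exists l, forall e : R, 0 < e -> exists2 d : R, 0 < d &
    forall w, cabs (w - z) < d ->
      cabs (f w - f z - l * (w - z)) <= e * cabs (w - z).
Proof.
move=> /cvg_ex[l fl]; exists l => e e0.
move/cvgrPdist_lt: fl => /(_ (rc e)).
rewrite ltcR => /(_ e0).
rewrite near_withinE /= => /nbhs_CCP[d d0 df]; exists d => // w zw.
have [->|wz] := eqVneq w z; first by rewrite !subrr mulr0 subrr cabs0 mulr0.
have := df (w - z); rewrite subr0 subr_eq0 => /(_ zw wz).
rewrite -cabs_ltE => H.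
have -> : f w - f z - l * (w - z) =
    - (l - (w - z)^-1 *: (f ((w - z) *: 1 + z) - f z)) * (w - z).
  have -> : (w - z) *: (1 : CC R) = w - z by exact: mulr1.
  rewrite subrK /GRing.scale /=; field.
  by rewrite subr_eq0.
by rewrite cabsM cabsN ler_wpM2r ?cabs_ge0 // ltW.
Qed.

End Modulus.

(** * Goursat's theorem for midpoint sums *)
Section Squares.
Variable R : realType.
Implicit Types (a d p w z : CC R) (x y t e M : R) (f g : CC R -> CC R) (N : nat).

Lemma rc0 : rc (0 : R) = 0. Proof. by []. Qed.
Lemma rc1 : rc (1 : R) = 1. Proof. by []. Qed.
Lemma rc2 : rc (2 : R) = 2.
Proof. by rewrite -[2 : R]/(1 + 1) rcD. Qed.
Lemma cabs2 : cabs (2 : CC R) = 2.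
Proof. by rewrite -rc2 cabs_rc ger0_norm. Qed.
Lemma cabs_half d : cabs (d / 2) = cabs d / 2.
Proof. by rewrite cabsM cabsV cabs2. Qed.
Lemma nested_intervals (x : nat -> R) :
  (forall m, x m <= x m.+1) ->
  (forall m, x m.+1 + 2^-1 ^+ m.+1 <= x m + 2^-1 ^+ m) ->
  exists X, forall m, x m <= X /\ X <= x m + 2^-1 ^+ m.
Proof.
move=> xS xhS.
have hom : {homo x : m n / (m <= n)%N >-> m <= n}.
  by apply: homo_leq => //; exact: le_trans.
have hom' m n : (m <= n)%N -> x n + 2^-1 ^+ n <= x m + 2^-1 ^+ m.
  elim: n => [|n IH]; first by rewrite leqn0 => /eqP ->.
  rewrite leq_eqVlt ltnS => /orP[/eqP -> //|/IH]; exact: le_trans.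
have xub m n : x n <= x m + 2^-1 ^+ m.
  have [mn|/ltnW nm] := leqP m n.
    by rewrite (le_trans _ (hom' _ _ mn)) // lerDl exprn_ge0.
  by rewrite (le_trans (hom _ _ nm)) // lerDl exprn_ge0.
have S0 : range x !=set0 by exists (x 0%N), 0%N.
have hs : has_sup (range x).
  by split=> //; exists (x 0%N + 2^-1 ^+ 0) => _ [n _ <-].
exists (sup (range x)) => m; split.
  by apply: ub_le_sup; [exact: hs.2|exists m].
by apply: ge_sup => // _ [n _ <-].
Qed.

(** The side [d] is complex, so squares may be rotated about the corner [a]; [loop] uses four such
    rotations. *)
Definition pt a d x y : CC R := a + (rc x + ci R * rc y) * d.

Definition in_square a d p := exists x y, [/\ 0 <= x <= 1, 0 <= y <= 1 & p = pt a d x y].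

Lemma halfX_pow m d : rc (2^-1 ^+ m.+1) * d = rc (2^-1 ^+ m) * d / 2.
Proof. by rewrite exprS rcM rcV rc2; field. Qed.

(** Compactness of the square in the form of Cousin's lemma: otherwise some quarter of every bad
    square is bad, and the nested bad squares shrink to a point whose small squares are all good. It
    serves both Goursat's theorem and [disk_margin]. *)
Lemma square_induction (P : CC R -> CC R -> Prop) a d :
  (forall a d, P a (d / 2) -> P (a + d / 2) (d / 2) ->
     P (a + ci R * (d / 2)) (d / 2) -> P (a + d / 2 + ci R * (d / 2)) (d / 2) -> P a d) ->
  (forall p, in_square a d p -> exists2 e, 0 < e &
     forall a' d', cabs d' < e -> in_square a' d' p ->
       (forall w, in_square a' d' w -> in_square a d w) -> P a' d') ->
  P a d.
Proof.
move=> Psub Ploc; apply: contrapT => nP.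
(* [u] holds the coordinates, relative to the initial square, of the corner of a bad square of
   generation [m]. *)
pose Q m (u : R * R) := ~ P (pt a d u.1 u.2) (rc (2^-1 ^+ m) * d).
pose h m : R := 2^-1 ^+ m.
have hS m : h m = h m.+1 + h m.+1 by rewrite /h exprS; lra.
have h0 m : 0 < h m by rewrite exprn_gt0.
pose ok m (u v : R * R) := [/\ u.1 <= v.1, v.1 + h m.+1 <= u.1 + h m,
   u.2 <= v.2 & v.2 + h m.+1 <= u.2 + h m].
have step (mu : nat * (R * R)) : exists v, Q mu.1 mu.2 -> Q mu.1.+1 v /\ ok mu.1 mu.2 v.
  case: mu => m [x y]; have [Qm|] := pselect (Q m (x, y)); last by exists 0.
  suff [v Hv] : exists v, Q m.+1 v /\ ok m (x, y) v by exists v.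
  apply: contrapT => nv; apply: Qm.
  have hm := h0 m.+1; have hSm := hS m.
  have Pch v : ok m (x, y) v -> P (pt a d v.1 v.2) (rc (h m.+1) * d).
    by move=> okv; apply: contrapT => nPv; apply: nv; exists v; split.
  have dE : rc (2^-1 ^+ m) * d / 2 = rc (h m.+1) * d by rewrite halfX_pow.
  apply: Psub; rewrite /= dE.
  - by apply: (Pch (x, y)); split => //=; lra.
  - have -> : pt a d x y + rc (h m.+1) * d = pt a d (x + h m.+1) y.
      by rewrite /pt rcD; ring.
    by apply: (Pch (x + h m.+1, y)); split => //=; lra.
  - have -> : pt a d x y + ci R * (rc (h m.+1) * d) = pt a d x (y + h m.+1).
      by rewrite /pt rcD; ring.
    by apply: (Pch (x, y + h m.+1)); split => //=; lra.
  - have -> : pt a d x y + rc (h m.+1) * d + ci R * (rc (h m.+1) * d) =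
        pt a d (x + h m.+1) (y + h m.+1).
      by rewrite /pt !rcD; ring.
    by apply: (Pch (x + h m.+1, y + h m.+1)); split => //=; lra.
have [F HF] := choice step.
pose u := fix u m := if m is k.+1 then F (k, u k) else (0, 0) : R * R.
have Qu m : Q m (u m).
  elim: m => [|m IH]; first by rewrite /Q /= /pt !rc0 expr0 rc1 mulr0 add0r mul0r addr0 mul1r.
  by have [] := HF (m, u m) IH.
have oku m : ok m (u m) (u m.+1) by have [] := HF (m, u m) (Qu m).
have [X HX] := @nested_intervals (fst \o u) (fun m => (let: And4 h _ _ _ := oku m in h))
  (fun m => (let: And4 _ h _ _ := oku m in h)).
have [Y HY] := @nested_intervals (snd \o u) (fun m => (let: And4 _ _ h _ := oku m in h))
  (fun m => (let: And4 _ _ _ h := oku m in h)).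
have umE m : [/\ 0 <= (u m).1, (u m).1 + h m <= 1, 0 <= (u m).2 & (u m).2 + h m <= 1].
  elim: m => [|m [IH1 IH2 IH3 IH4]]; first by split => //=; rewrite /h expr0; lra.
  by have [] := oku m; split; lra.
have [e e0 He] : exists2 e, 0 < e &
     forall a' d', cabs d' < e -> in_square a' d' (pt a d X Y) ->
       (forall w, in_square a' d' w -> in_square a d w) -> P a' d'.
  apply: Ploc; exists X, Y; split => //.
    by have /= := HX 0%N; rewrite expr0; lra.
  by have /= := HY 0%N; rewrite expr0; lra.
have [m hm] : exists m, h m * cabs d < e.
  have [m _] := near_infty_natSinv_expn_lt (PosNum (divr_gt0 e0 (ltr_pwDr ltr01 (cabs_ge0 d)))).
  move=> /(_ m (leqnn m)) /=.
  have d1 : 0 < cabs d + 1 by have := cabs_ge0 d; lra.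
  rewrite ltr_pdivlMr // => lt_e; exists m.
  rewrite (le_lt_trans _ lt_e) // /h exprVn div1r ler_wpM2l ?invr_ge0 ?exprn_ge0 //.
  by rewrite lerDl.
have hm0 := h0 m.
apply: (Qu m); apply: He.
- by rewrite cabsM cabs_rc ger0_norm // ltW.
- exists ((X - (u m).1) / h m), ((Y - (u m).2) / h m); split.
  + have /= := HX m; rewrite -/(h m) => ?.
    by apply/andP; split; [apply: divr_ge0; lra|rewrite ler_pdivrMr //; lra].
  + have /= := HY m; rewrite -/(h m) => ?.
    by apply/andP; split; [apply: divr_ge0; lra|rewrite ler_pdivrMr //; lra].
  + rewrite /pt !rcM !rcV -/(h m) !rcD !rcN; field.
    by rewrite -cabs_gt0 cabs_rc ger0_norm // ltW.
- move=> w [x [y [/andP[x0 x1] /andP[y0 y1] ->]]].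
  have [u1 u2 u3 u4] := umE m.
  exists ((u m).1 + h m * x), ((u m).2 + h m * y); split.
  + by apply/andP; split; [rewrite addr_ge0 // mulr_ge0 // ltW|have := ler_piMr (ltW hm0) x1; lra].
  + by apply/andP; split; [rewrite addr_ge0 // mulr_ge0 // ltW|have := ler_piMr (ltW hm0) y1; lra].
  + by rewrite /pt -/(h m) !rcD !rcM; ring.
Qed.

End Squares.

(** * Midpoint sums along edges of squares, and Goursat's estimate *)

Section EdgeSums.
Variable R : realType.
Implicit Types (a d p w z : CC R) (x y t e M : R) (f g : CC R -> CC R) (N : nat).

(** The midpoint rule with [2 ^ N] equal pieces for the integral of [f] from [a] to [a + d]. Halving
    recursively makes refinement of the sum agree with subdivision of the squares. *)
Fixpoint edge f N a d : CC R :=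
  if N is N'.+1 then edge f N' a (d / 2) + edge f N' (a + d / 2) (d / 2)
  else f (a + d / 2) * d.

Lemma edge_rev f N a d : edge f N (a + d) (- d) = - edge f N a d.
Proof.
elim: N a d => [|N IH] a d /=; first by rewrite mulrN; congr (- (f _ * _)); field.
have -> : a + d = a + d / 2 + d / 2 by field.
by rewrite mulNr IH addrK IH opprD addrC.
Qed.

(* This exactness is the reason for sampling at midpoints. *)
Lemma edge_affine N a d u v :
  edge (fun z => u + v * z) N a d = u * d + v * (a * d + d ^+ 2 / 2).
Proof. by elim: N a d => [|N IH] a d /=; rewrite ?IH; field. Qed.

Lemma edgeB f g N a d :
  edge (fun z => f z - g z) N a d = edge f N a d - edge g N a d.
Proof. by elim: N a d => [|N IH] a d /=; rewrite ?IH; ring. Qed.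

Lemma edgeZ f c N a d : edge (fun z => c * f z) N a d = c * edge f N a d.
Proof. by elim: N a d => [|N IH] a d /=; rewrite ?IH; ring. Qed.

Lemma edge_halves (P : CC R -> Prop) a d :
  (forall t, 0 <= t <= 1 -> P (a + rc t * d)) ->
  (forall t, 0 <= t <= 1 -> P (a + rc t * (d / 2))) /\
  (forall t, 0 <= t <= 1 -> P (a + d / 2 + rc t * (d / 2))).
Proof.
move=> Pad; split=> t t01.
  have -> : rc t * (d / 2) = rc (t / 2) * d by rewrite rcM rcV rc2; ring.
  by apply: Pad; lra.
have -> : a + d / 2 + rc t * (d / 2) = a + rc ((1 + t) / 2) * d.
  by rewrite rcM rcV rcD rc2 rc1; ring.
by apply: Pad; lra.
Qed.

Lemma edge_mid a d : a + d / 2 = a + rc 2^-1 * d.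
Proof. by rewrite rcV rc2; ring. Qed.

Lemma eq_edge f g N a d :
  (forall t, 0 <= t <= 1 -> f (a + rc t * d) = g (a + rc t * d)) ->
  edge f N a d = edge g N a d.
Proof.
elim: N a d => [|N IH] a d fg /=; first by rewrite edge_mid fg //; lra.
by have [? ?] := edge_halves (P := fun z => f z = g z) fg; congr (_ + _); apply: IH.
Qed.

Lemma edge_le f N a d M :
  (forall t, 0 <= t <= 1 -> cabs (f (a + rc t * d)) <= M) ->
  cabs (edge f N a d) <= M * cabs d.
Proof.
elim: N a d => [|N IH] a d fM /=.
  by rewrite cabsM ler_wpM2r ?cabs_ge0 // edge_mid fM //; lra.
have [f1 f2] := edge_halves (P := fun z => cabs (f z) <= M) fM.
apply: le_trans (cabsD _ _) _.
by have := IH _ _ f1; have := IH _ _ f2; rewrite cabs_half; lra.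
Qed.

Lemma edge_im_ge f N a d m :
  (forall t, 0 <= t <= 1 -> m <= cim (f (a + rc t * d) * d)) ->
  m <= cim (edge f N a d).
Proof.
elim: N a d m => [|N IH] a d m fm /=; first by rewrite edge_mid fm //; lra.
have [f1 f2] := edge_halves (P := fun z => m <= cim (f z * d)) fm.
have half z : cim (f z * (d / 2)) = cim (f z * d) / 2.
  have -> : f z * (d / 2) = f z * d * rc 2^-1 by rewrite rcV rc2; ring.
  by rewrite cimM cim_rc cre_rc mulr0 add0r.
rewrite cimD.
have H1 : m / 2 <= cim (edge f N (a + d / 2) (d / 2)).
  by apply: IH => t t01; rewrite half; have /= := f2 t t01; lra.
have H2 : m / 2 <= cim (edge f N a (d / 2)).
  by apply: IH => t t01; rewrite half; have /= := f1 t t01; lra.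
lra.
Qed.

(** The counterclockwise boundary integral; the top and left edges are sampled along [d] and
    [ci R * d] and hence carry a minus sign. *)
Definition bdry f N a d : CC R :=
  edge f N a d + edge f N (a + d) (ci R * d) - edge f N (a + ci R * d) d
  - edge f N a (ci R * d).

(** Each inner edge belongs to two quarters and occurs with opposite signs and the same sample
    points, so the cancellation is exact and not merely asymptotic. *)
Lemma bdryS f N a d : bdry f N.+1 a d =
  bdry f N a (d / 2) + bdry f N (a + d / 2) (d / 2) +
  bdry f N (a + ci R * (d / 2)) (d / 2) + bdry f N (a + d / 2 + ci R * (d / 2)) (d / 2).
Proof.
rewrite /bdry /=; set h := d / 2; have -> : ci R * d / 2 = ci R * h by rewrite mulrA.
have -> : a + d = a + h + h by rewrite /h; field.
have -> : a + ci R * d = a + ci R * h + ci R * h by rewrite /h; field.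
have -> : a + ci R * h + h = a + h + ci R * h by ring.
have -> : a + ci R * h + ci R * h + h = a + h + ci R * h + ci R * h by ring.
have -> : a + h + ci R * h + h = a + h + h + ci R * h by ring.
ring.
Qed.

Lemma bdry_le f N a d M : (forall p, in_square a d p -> cabs (f p) <= M) ->
  cabs (bdry f N a d) <= 4 * M * cabs d.
Proof.
move=> fM; have E x y : 0 <= x <= 1 -> 0 <= y <= 1 -> cabs (f (pt a d x y)) <= M.
  by move=> ? ?; apply: fM; exists x, y.
have i0 : 0 <= (0 : R) <= 1 by rewrite lexx ler01.
have i1 : 0 <= (1 : R) <= 1 by rewrite lexx ler01.
have idE : cabs (ci R * d) = cabs d by rewrite cabsM cabs_ci mul1r.
have e1 : cabs (edge f N a d) <= M * cabs d.
  by apply: edge_le => t t01; have := E t 0 t01 i0; rewrite /pt rc0 mulr0 addr0.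
have e2 : cabs (edge f N (a + d) (ci R * d)) <= M * cabs d.
  rewrite -idE; apply: edge_le => t t01; have := E 1 t i1 t01.
  by rewrite /pt rc1 (_ : a + (1 + ci R * rc t) * d = a + d + rc t * (ci R * d)); last ring.
have e3 : cabs (edge f N (a + ci R * d) d) <= M * cabs d.
  apply: edge_le => t t01; have := E t 1 t01 i1.
  by rewrite /pt rc1 (_ : a + (rc t + ci R * 1) * d = a + ci R * d + rc t * d); last ring.
have e4 : cabs (edge f N a (ci R * d)) <= M * cabs d.
  rewrite -idE; apply: edge_le => t t01; have := E 0 t i0 t01.
  by rewrite /pt rc0 (_ : a + (0 + ci R * rc t) * d = a + rc t * (ci R * d)); last ring.
have := cabsD (edge f N a d + edge f N (a + d) (ci R * d) - edge f N (a + ci R * d) d)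
  (- edge f N a (ci R * d)).
have := cabsD (edge f N a d + edge f N (a + d) (ci R * d)) (- edge f N (a + ci R * d) d).
have := cabsD (edge f N a d) (edge f N (a + d) (ci R * d)).
by rewrite !cabsN -/(bdry f N a d); lra.
Qed.

Lemma bdryB f g N a d :
  bdry (fun z => f z - g z) N a d = bdry f N a d - bdry g N a d.
Proof. by rewrite /bdry !edgeB; ring. Qed.

Lemma bdry_affine N a d u v : bdry (fun z => u + v * z) N a d = 0.
Proof. by rewrite /bdry !edge_affine; have := ci2 R; move: (ci R) => i i2; field: i2. Qed.

Lemma in_square_dist a d p w : in_square a d p -> in_square a d w ->
  cabs (w - p) <= 2 * cabs d.
Proof.
move=> [x [y [xI yI ->]]] [x' [y' [x'I y'I ->]]].
have -> : pt a d x' y' - pt a d x y = (rc (x' - x) + ci R * rc (y' - y)) * d.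
  by rewrite /pt !rcD !rcN; ring.
rewrite cabsM ler_wpM2r ?cabs_ge0 // (le_trans (cabsD _ _)) //.
rewrite cabsM cabs_ci !cabs_rc mul1r.
have -> : (2 : R) = 1 + 1 by [].
by apply: lerD; rewrite ler_norml; lra.
Qed.

(** The bound is additive over quarters, since [|d| ^ 2] is four times [|d / 2| ^ 2]. On a small
    square [f] may be replaced by its remainder after the affine part, because midpoint sums of
    affine functions around a square vanish. Holding for all large [N], the estimate replaces the
    vanishing of an integral. *)
Lemma goursat f a d : (forall p, in_square a d p -> derivable f p 1) ->
  forall e, 0 < e -> exists N0, forall N, (N0 <= N)%N ->
    cabs (bdry f N a d) <= e * cabs d ^+ 2.
Proof.
move=> df e e0.
apply: (@square_induction _
  (fun a d => exists N0, forall N, (N0 <= N)%N -> cabs (bdry f N a d) <= e * cabs d ^+ 2)).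
  move=> {df}a {}d [N1 H1] [N2 H2] [N3 H3] [N4 H4].
  exists (maxn (maxn N1 N2) (maxn N3 N4)).+1 => -[//|N]; rewrite ltnS !geq_max.
  move=> /andP[/andP[/H1 {}H1 /H2 {}H2] /andP[/H3 {}H3 /H4 {}H4]].
  rewrite bdryS; move: H1 H2 H3 H4; rewrite !cabs_half.
  set b1 := bdry _ _ _ _; set b2 := bdry _ _ _ _; set b3 := bdry _ _ _ _.
  set b4 := bdry _ _ _ _.
  have := cabsD (b1 + b2 + b3) b4; have := cabsD (b1 + b2) b3; have := cabsD b1 b2.
  by rewrite expr_div_n; lra.
(* The 8 absorbs the factor 4 of [bdry_le] and the factor 2 of [in_square_dist]. *)
move=> p /df/derivableE[l Hl]; have [|D D0 HD] := Hl (e / 8); first by lra.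
exists (D / 2) => [|a' d' d'D pa'd' _]; first by lra.
exists 0%N => N _.
have -> : bdry f N a' d' = bdry (fun w => f w - (f p - l * p + l * w)) N a' d'.
  by rewrite bdryB bdry_affine subr0.
apply: (@le_trans _ _ (4 * (e / 8 * (2 * cabs d')) * cabs d')); last by lra.
apply: bdry_le => w wa'd'.
have wp := in_square_dist pa'd' wa'd'.
have -> : f w - (f p - l * p + l * w) = f w - f p - l * (w - p) by ring.
by rewrite (le_trans (HD _ _)) ?ler_wpM2l //; lra.
Qed.

End EdgeSums.

(** * Cauchy and Harnack estimates *)
Section CornerAndLoop.
Variable R : realType.
Implicit Types (a c d p w z : CC R) (x y t e s r M : R) (f g : CC R -> CC R) (N : nat).

Lemma halfX_lt x e : 0 < e -> exists m, 2^-1 ^+ m * x < e.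
Proof.
move=> e0; have x0 := normr_ge0 x.
have [m _] := near_infty_natSinv_expn_lt (PosNum (divr_gt0 e0 (ltr_pwDr ltr01 x0))).
move=> /(_ m (leqnn m)) /=.
have d1 : 0 < `|x| + 1 by lra.
rewrite ltr_pdivlMr // => lt_e; exists m.
rewrite (le_lt_trans _ lt_e) // exprVn div1r ler_wpM2l ?invr_ge0 ?exprn_ge0 //.
by have := ler_norm x; lra.
Qed.

Lemma pt_child a d b1 b2 x y :
  pt (a + (rc b1 + ci R * rc b2) * (d / 2)) (d / 2) x y =
  pt a d ((b1 + x) / 2) ((b2 + y) / 2).
Proof. by rewrite /pt !rcM !rcD rcV rc2; ring. Qed.

Lemma pt_eq_corner a d x y : d != 0 -> pt a d x y = a -> x = 0 /\ y = 0.
Proof.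
move=> d0; rewrite /pt -[X in _ = X]addr0 => /addrI /eqP.
rewrite mulf_eq0 (negPf d0) orbF => /eqP E.
by have := congr1 (@cre R) E; have := congr1 (@cim R) E; rewrite !cE /=; lra.
Qed.

(** Goursat with a possible singularity at the corner [a], near which [f] is bounded. Each
    subdivision splits off three quarters that avoid [a], to which [goursat] applies; after [m] of
    them the remaining square has side [2^-1 ^+ m * cabs d] and is estimated trivially. *)
Lemma goursat_corner f a d M m :
  (forall p, in_square a d p -> p != a -> derivable f p 1) ->
  (forall p, in_square a (rc (2^-1 ^+ m) * d) p -> cabs (f p) <= M) ->
  forall e, 0 < e -> exists N0, forall N, (N0 <= N)%N ->
    cabs (bdry f N a d) <= e + 4 * M * (2^-1 ^+ m * cabs d).
Proof.
elim: m d => [|m IH] d df fM e e0.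
  exists 0%N => N _; move: fM; rewrite expr0 rc1 !mul1r => fM.
  by rewrite (le_trans (bdry_le _ fM)) //; lra.
have [d0|d0] := eqVneq d 0.
  exists 0%N => N _.
  suff -> : bdry f N a d = 0 by rewrite cabs0 d0 cabs0 !mulr0 addr0 ltW.
  rewrite /bdry d0 mulr0 !addr0; ring.
have sub b1 b2 p : 0 <= b1 <= 1 -> 0 <= b2 <= 1 ->
    in_square (a + (rc b1 + ci R * rc b2) * (d / 2)) (d / 2) p ->
    in_square a d p /\ (0 < b1 + b2 -> p != a).
  move=> b1I b2I [x [y [xI yI ->]]]; rewrite pt_child; split.
    by exists ((b1 + x) / 2), ((b2 + y) / 2); split => //; lra.
  move=> b_gt0; apply/negP => /eqP /(pt_eq_corner d0); lra.
have df0 p : in_square a (d / 2) p -> p != a -> derivable f p 1.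
  move=> pad; apply: df.
  apply: (proj1 (sub 0 0 p _ _ _)); rewrite ?lexx ?ler01 //.
  by rewrite rc0 mulr0 addr0 mul0r addr0.
have fM0 p : in_square a (rc (2^-1 ^+ m) * (d / 2)) p -> cabs (f p) <= M.
  move=> pad; apply: fM.
  suff -> : rc (2^-1 ^+ m.+1) * d = rc (2^-1 ^+ m) * (d / 2) by [].
  by rewrite halfX_pow; ring.
have [|N0 HN0] := IH (d / 2) df0 fM0 (e / 4); first by lra.
(* Chosen so that [goursat] gives at most [e / 4] on each quarter; the 1 keeps the denominator
   positive. *)
pose e' := e / (1 + cabs d ^+ 2).
have e'0 : 0 < e' by rewrite divr_gt0 // ltr_pwDl // sqr_ge0.
have e'e : e' * cabs d ^+ 2 <= e.
  rewrite /e' mulrAC ler_pdivrMr ?ltr_pwDl ?sqr_ge0 //.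
  by rewrite ler_wpM2l ?(ltW e0) // lerDr.
have G b1 b2 : 0 <= b1 <= 1 -> 0 <= b2 <= 1 -> 0 < b1 + b2 ->
    exists N0, forall N, (N0 <= N)%N ->
      cabs (bdry f N (a + (rc b1 + ci R * rc b2) * (d / 2)) (d / 2)) <= e / 4.
  move=> b1I b2I b_gt0.
  have [|N1 HN1] := @goursat _ f (a + (rc b1 + ci R * rc b2) * (d / 2)) (d / 2) _ e' e'0.
    by move=> p /sub-/(_ b1I b2I)[pad pa]; apply: df => //; exact: pa.
  by exists N1 => N /HN1 /le_trans; apply; rewrite cabs_half expr_div_n; lra.
have i0 : 0 <= (0 : R) <= 1 by rewrite lexx ler01.
have i1 : 0 <= (1 : R) <= 1 by rewrite lexx ler01.
have [|N1 HN1] := G 1 0 i1 i0; first by rewrite addr0.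
have [|N2 HN2] := G 0 1 i0 i1; first by rewrite add0r.
have [|N3 HN3] := G 1 1 i1 i1; first by rewrite addr_gt0.
exists (maxn (maxn N0 N1) (maxn N2 N3)).+1 => -[//|N]; rewrite ltnS !geq_max.
move=> /andP[/andP[/HN0 {}HN0 /HN1 {}HN1] /andP[/HN2 {}HN2 /HN3 {}HN3]].
rewrite bdryS; move: HN0 HN1 HN2 HN3; rewrite rc0 rc1 mulr0 addr0 mulr1 add0r mul1r.
have -> : a + (1 + ci R) * (d / 2) = a + d / 2 + ci R * (d / 2) by ring.
rewrite cabs_half exprS.
set b1 := bdry _ _ _ _; set b2 := bdry _ _ _ _; set b3 := bdry _ _ _ _.
set b4 := bdry _ _ _ _.
have := cabsD (b1 + b2 + b3) b4; have := cabsD (b1 + b2) b3; have := cabsD b1 b2.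
lra.
Qed.

(** The part of [bdry] along the two edges that do not meet the corner [a]. *)
Definition outer f N a d : CC R := edge f N (a + d) (ci R * d) - edge f N (a + ci R * d) d.

(** The boundary of the square of side [2 * d] centred at [a], assembled from four squares with
    common corner [a]. In [loop_bdry] the four edges that meet at [a] cancel. *)
Definition loop f N a d : CC R :=
  outer f N a d + outer f N a (ci R * d) + outer f N a (- d) + outer f N a (- (ci R * d)).

Lemma loop_bdry f N a d : loop f N a d =
  bdry f N a d + bdry f N a (ci R * d) + bdry f N a (- d) + bdry f N a (- (ci R * d)).
Proof.
rewrite /loop /outer /bdry.
have -> : ci R * (ci R * d) = - d by rewrite mulrA ci2 mulN1r.
have -> : ci R * - d = - (ci R * d) by rewrite mulrN.
have -> : ci R * - (ci R * d) = d by rewrite mulrN mulrA ci2 mulN1r opprK.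
ring.
Qed.

Lemma outer_le f N a d M :
  (forall w, cabs d <= cabs (w - a) <= 2 * cabs d -> cabs (f w) <= M) ->
  cabs (outer f N a d) <= 2 * M * cabs d.
Proof.
move=> fM; rewrite /outer (le_trans (cabsD _ _)) // cabsN.
have H u v t : cabs (a + u + rc t * v - a) = cabs (u + rc t * v).
  by congr cabs; ring.
have H1 t : 0 <= t <= 1 -> 1 <= cabs (1 + rc t * ci R) <= 2.
  move=> tI; apply/andP; split.
    by apply: le_trans (cre_le_cabs _); rewrite -rc1 !cE; lra.
  by rewrite (le_trans (cabsD _ _)) // cabs1 cabsM cabs_ci cabs_rc ger0_norm; lra.
have H2 t : 0 <= t <= 1 -> 1 <= cabs (ci R + rc t) <= 2.
  move=> tI; apply/andP; split.
    by apply: le_trans (cim_le_cabs _); rewrite !cE; lra.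
  by rewrite (le_trans (cabsD _ _)) // cabs_ci cabs_rc ger0_norm; lra.
have E1 : cabs (edge f N (a + d) (ci R * d)) <= M * cabs d.
  have idE : cabs (ci R * d) = cabs d by rewrite cabsM cabs_ci mul1r.
  rewrite -idE.
  apply: edge_le => t /H1 tI; apply: fM; rewrite H.
  have -> : d + rc t * (ci R * d) = (1 + rc t * ci R) * d by ring.
  by rewrite cabsM ler_peMl ?ler_wpM2r ?cabs_ge0 //; case/andP: tI.
have E2 : cabs (edge f N (a + ci R * d) d) <= M * cabs d.
  apply: edge_le => t /H2 tI; apply: fM; rewrite H.
  have -> : ci R * d + rc t * d = (ci R + rc t) * d by ring.
  by rewrite cabsM ler_peMl ?ler_wpM2r ?cabs_ge0 //; case/andP: tI.
by lra.
Qed.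

(** The integral itself would give [pi / 2]. A bound away from 0 suffices: on each of the two edges
    the integrand has imaginary part [1 / (1 + t ^ 2)], up to reparametrisation, which is at least
    1/2. Thus [loop] of [(w - a)^-1] has modulus at least 4, in place of the value [2 pi i]. *)
Lemma outer_inv_im_ge N a d : d != 0 ->
  1 <= cim (outer (fun w => (w - a)^-1) N a d).
Proof.
move=> d0; rewrite /outer -edge_rev cimD.
have cabs2_ge t : 0 <= t <= 1 -> 2^-1 <= 1 / (1 + t ^+ 2).
  move=> tI; have t2 : t ^+ 2 <= 1 by rewrite expr_le1 //; lra.
  have t20 := sqr_ge0 t.
  by rewrite ler_pdivlMr; lra.
have E1 : 2^-1 <= cim (edge (fun w => (w - a)^-1) N (a + d) (ci R * d)).
  apply: edge_im_ge => t tI.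
  have -> : (a + d + rc t * (ci R * d) - a)^-1 * (ci R * d) = (1 + rc t * ci R)^-1 * ci R.
    have -> : a + d + rc t * (ci R * d) - a = (1 + rc t * ci R) * d by ring.
    by rewrite invfM -mulrA [X in _ * X]mulrC -mulrA divff // mulr1.
  rewrite cimM cre_ci cim_ci mulr0 addr0 mulr1 creV sqr_cabs -rc1 !cE.
  by rewrite !(mulr0, mul0r, mulr1, subr0, addr0, add0r) expr1n; exact: cabs2_ge.
have E2 : 2^-1 <= cim (edge (fun w => (w - a)^-1) N (a + ci R * d + d) (- d)).
  apply: edge_im_ge => t tI.
  have -> : (a + ci R * d + d + rc t * - d - a)^-1 * - d = - (rc (1 - t) + ci R)^-1.
    have -> : a + ci R * d + d + rc t * - d - a = (rc (1 - t) + ci R) * d.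
      by rewrite rcD rcN rc1; ring.
    by rewrite invfM mulrN -mulrA mulVf // mulr1.
  rewrite cimN cimV sqr_cabs !cE.
  rewrite !(mulr0, mul0r, mulr1, subr0, addr0, add0r) expr1n mulNr opprK addrC.
  by apply: cabs2_ge; lra.
lra.
Qed.

Lemma derivable_eps f z l :
  (forall e, 0 < e -> exists2 D, 0 < D & forall w, cabs (w - z) < D ->
      cabs (f w - f z - l * (w - z)) <= e * cabs (w - z)) -> derivable f z 1.
Proof.
move=> fl; apply/cvg_ex; exists l; apply/cvgrPdist_le => e1 e1_gt0.
have [-> e0] := gt0_rc e1_gt0.
have [D D0 HD] := fl _ e0.
rewrite near_withinE; apply/nbhs_CCP; exists D => // h; rewrite subr0 => hD h0.
have /HD : cabs (h + z - z) < D by rewrite addrK.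
rewrite addrK => H; rewrite normCE lecR.
have -> : h *: (1 : CC R) = h by exact: mulr1.
have -> : l - h^-1 *: (f (h + z) - f z) = - h^-1 * (f (h + z) - f z - l * h).
  by rewrite /GRing.scale /=; field.
by rewrite cabsM cabsN cabsV mulrC ler_pdivrMr // cabs_gt0.
Qed.

Lemma derivable_lipschitz f z : derivable f z 1 ->
  exists K D, [/\ 0 <= K, 0 < D & forall w, cabs (w - z) < D ->
    cabs (f w - f z) <= K * cabs (w - z)].
Proof.
move=> /derivableE[l /(_ 1 ltr01)[D D0 HD]]; exists (1 + cabs l), D.
split=> // [|w /HD H]; first by rewrite addr_ge0 ?cabs_ge0.
have -> : f w - f z = f w - f z - l * (w - z) + l * (w - z) by ring.
by rewrite (le_trans (cabsD _ _)) // cabsM; lra.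
Qed.

Lemma derivable_div_sub f z0 w : w != z0 -> derivable f w 1 ->
  derivable (fun v => f v / (v - z0)) w 1.
Proof.
move=> wz0 df; apply: (derivableM df); apply: derivableV; first by rewrite subr_eq0.
by apply: derivableB; [exact: derivable_id|exact: derivable_cst].
Qed.

Lemma loop_le f N a d M :
  (forall w, cabs d <= cabs (w - a) <= 2 * cabs d -> cabs (f w) <= M) ->
  cabs (loop f N a d) <= 8 * M * cabs d.
Proof.
move=> fM; rewrite /loop.
have idE : cabs (ci R * d) = cabs d by rewrite cabsM cabs_ci mul1r.
have H1 : cabs (outer f N a d) <= 2 * M * cabs d by exact: outer_le.
have H2 : cabs (outer f N a (ci R * d)) <= 2 * M * cabs d.
  by rewrite -idE; apply: outer_le => w; rewrite idE; exact: fM.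
have H3 : cabs (outer f N a (- d)) <= 2 * M * cabs d.
  by rewrite -(cabsN d); apply: outer_le => w; rewrite cabsN; exact: fM.
have H4 : cabs (outer f N a (- (ci R * d))) <= 2 * M * cabs d.
  by rewrite -idE -(cabsN (ci R * d)); apply: outer_le => w; rewrite cabsN idE; exact: fM.
move: H1 H2 H3 H4.
set b1 := outer _ _ _ _; set b2 := outer _ _ _ _; set b3 := outer _ _ _ _.
set b4 := outer _ _ _ _.
have := cabsD (b1 + b2 + b3) b4; have := cabsD (b1 + b2) b3; have := cabsD b1 b2.
lra.
Qed.

Lemma loop_inv_ge N a d : d != 0 -> 4 <= cabs (loop (fun w => (w - a)^-1) N a d).
Proof.
move=> d0; have id0 : ci R * d != 0 by rewrite mulf_neq0 // -cabs_gt0 cabs_ci.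
apply: le_trans (cim_le_cabs _); rewrite /loop 3!cimD.
have := outer_inv_im_ge N a d0; have := outer_inv_im_ge N a id0.
have := @outer_inv_im_ge N a (- d); have := @outer_inv_im_ge N a (- (ci R * d)).
by rewrite !oppr_eq0 => /(_ id0) + /(_ d0); lra.
Qed.

End CornerAndLoop.

(** * A Cauchy estimate at the centre of an annulus *)

Section CauchyEstimate.
Variable R : realType.
Implicit Types (a c d p w z : CC R) (x y t e s r M : R) (f g : CC R -> CC R) (N : nat).

(** The quotient [k] is holomorphic off [z0] and bounded near it, so its sum over [loop] is small by
    [goursat_corner]. Hence [f z0] times the loop of [(w - z0)^-1], of modulus at least 4, is almost
    the loop of [f w / (w - z0)], of modulus at most [8 * M]. *)
Lemma cauchy_center f z0 s M : 0 < s ->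
  (forall w, cabs (w - z0) <= 2 * s -> derivable f w 1) ->
  (forall w, s <= cabs (w - z0) <= 2 * s -> cabs (f w) <= M) ->
  cabs (f z0) <= 2 * M.
Proof.
move=> s0 df fM; apply/ler_addgt0Pr => e e0.
pose k w := (f w - f z0) / (w - z0).
have [K [D [K0 D0 fK]]] : exists K D, [/\ 0 <= K, 0 < D & forall w, cabs (w - z0) < D ->
    cabs (f w - f z0) <= K * cabs (w - z0)].
  by apply: derivable_lipschitz; apply: df; rewrite subrr cabs0; lra.
(* At [w = z0] the inverse of 0 is 0, so [k z0 = 0] and the bound holds there too. *)
have kK w : cabs (w - z0) < D -> cabs (k w) <= K.
  move=> /fK; rewrite /k; have [->|wz] := eqVneq w z0; first by rewrite !subrr mul0r cabs0.
  by rewrite cabsM cabsV -ler_pdivlMr ?invr_gt0 ?cabs_gt0 ?subr_eq0 // invrK.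
have dk w : w != z0 -> cabs (w - z0) <= 2 * s -> derivable k w 1.
  move=> wz /df dfw; apply: (@derivable_div_sub R (fun v => f v - f z0) z0 w wz).
  exact: (derivableB dfw (derivable_cst (f z0) w 1)).
have B d : cabs d = s -> exists N0, forall N, (N0 <= N)%N -> cabs (bdry k N z0 d) <= e.
  move=> ds.
  (* The first bound puts the small corner square inside the disk where [k] is bounded by [K]; the
     second makes its contribution [4 * K * eta] at most [e / 2]. *)
  pose eta := Num.min (D / 3) (e / (8 * (K + 1))).
  have K1 : 0 < 8 * (K + 1) by lra.
  have [|m] := @halfX_lt R s eta; first by rewrite lt_min !divr_gt0.
  rewrite lt_min !ltr_pdivlMr // => /andP[hD hK].
  have h0 : 0 <= 2^-1 ^+ m * s by rewrite mulr_ge0 ?exprn_ge0 // ltW.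
  have z0in v : in_square z0 v z0.
    exists 0, 0; split; rewrite ?lexx ?ler01 //.
    by rewrite /pt rc0 mulr0 addr0 mul0r addr0.
  have dk' p : in_square z0 d p -> p != z0 -> derivable k p 1.
    by move=> pz0 pz; apply: dk => //; rewrite -ds; exact: in_square_dist pz0.
  have kK' p : in_square z0 (rc (2^-1 ^+ m) * d) p -> cabs (k p) <= K.
    move=> pz; apply: kK; apply: le_lt_trans (in_square_dist (z0in _) pz) _.
    by rewrite cabsM cabs_rc ger0_norm ?exprn_ge0 // ds; lra.
  have [|N0 HN0] := goursat_corner dk' kK' (e := e / 2); first by lra.
  exists N0 => N /HN0 /le_trans; apply; rewrite ds.
  by move: (2^-1 ^+ m * s) h0 hK => h h0 hK; have := mulr_ge0 h0 K0; lra.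
pose d : CC R := rc s.
have ds : cabs d = s by rewrite cabs_rc gtr0_norm.
have d0 : d != 0 by rewrite -cabs_gt0 ds.
have [|N1 HN1] := B d; first exact: ds.
have [|N2 HN2] := B (ci R * d); first by rewrite cabsM cabs_ci mul1r.
have [|N3 HN3] := B (- d); first by rewrite cabsN.
have [|N4 HN4] := B (- (ci R * d)); first by rewrite cabsN cabsM cabs_ci mul1r.
pose N := maxn (maxn N1 N2) (maxn N3 N4).
have kE : loop k N z0 d = loop (fun w => f w / (w - z0)) N z0 d
    - f z0 * loop (fun w => (w - z0)^-1) N z0 d.
  rewrite {1}/loop.
  have O u : outer k N z0 u = outer (fun w => f w / (w - z0)) N z0 u
      - f z0 * outer (fun w => (w - z0)^-1) N z0 u.
    rewrite /outer mulrBr -!edgeZ.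
    have EK b v : edge k N b v = edge (fun w => f w / (w - z0)) N b v -
        edge (fun w => f z0 * (w - z0)^-1) N b v.
      by rewrite -edgeB; apply: eq_edge => t _; rewrite /k mulrBl.
    by rewrite !EK; ring.
  by rewrite !O /loop; ring.
have Lk : cabs (loop k N z0 d) <= 4 * e.
  rewrite loop_bdry.
  have := HN1 N; have := HN2 N; have := HN3 N; have := HN4 N.
  rewrite !leq_max !leqnn !orbT => /(_ isT) + /(_ isT) + /(_ isT) + /(_ isT).
  set b1 := bdry _ _ _ _; set b2 := bdry _ _ _ _; set b3 := bdry _ _ _ _.
  set b4 := bdry _ _ _ _.
  have := cabsD (b4 + b3 + b2) b1; have := cabsD (b4 + b3) b2; have := cabsD b4 b3.
  lra.
have Lf : cabs (loop (fun w => f w / (w - z0)) N z0 d) <= 8 * M.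
  have -> : 8 * M = 8 * (M / s) * cabs d by rewrite ds; field; rewrite gt_eqF.
  apply: loop_le => w; rewrite ds => wI; rewrite cabsM cabsV.
  apply: ler_pM; rewrite ?invr_ge0 ?cabs_ge0 ?fM //.
  by case/andP: wI => ws _; rewrite lef_pV2 ?posrE // (lt_le_trans s0).
have L1 := loop_inv_ge N z0 d0.
have : cabs (f z0) * cabs (loop (fun w => (w - z0)^-1) N z0 d) <= 8 * M + 4 * e.
  rewrite -cabsM.
  have -> : f z0 * loop (fun w => (w - z0)^-1) N z0 d =
     loop (fun w => f w / (w - z0)) N z0 d - loop k N z0 d by rewrite kE; ring.
  by rewrite (le_trans (cabsD _ _)) // cabsN lerD.
have := ler_wpM2l (cabs_ge0 (f z0)) L1; lra.
Qed.

End CauchyEstimate.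

(** * Weak Schwarz lemma and Harnack's inequality *)

Section SchwarzHarnack.
Variable R : realType.
Implicit Types (a c d p w z : CC R) (x y t e s r M : R) (f g F : CC R -> CC R) (N : nat).

(* [w - c] divides [g ^ 2] to second order, so the quotient is holomorphic at
   [c] too, without appeal to removable singularities. *)
Lemma derivable_sqr_div g c : derivable g c 1 -> g c = 0 ->
  derivable (fun w => g w ^+ 2 / (w - c)) c 1.
Proof.
move=> /derivableE[l Hl] gc0; apply: (@derivable_eps R _ c (l ^+ 2)) => e e0.
have l0 := cabs_ge0 l.
pose e1 := Num.min 1 (e / (2 * cabs l + 1)).
have e10 : 0 < e1 by rewrite lt_min ltr01 divr_gt0 //; lra.
have [D D0 HD] := Hl _ e10; exists D => // w wD.
have e1e : e1 * (2 * cabs l + 1) <= e.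
  by rewrite -ler_pdivlMr; [rewrite ge_min lexx orbT|lra].
have e1_1 : e1 <= 1 by rewrite ge_min lexx.
rewrite subrr invr0 mulr0 subr0.
have [->|wc] := eqVneq w c; first by rewrite !subrr invr0 !mulr0 subr0 cabs0 mulr0.
have wc0 : w - c != 0 by rewrite subr_eq0.
have := HD w wD; rewrite gc0 subr0 => H.
have -> : g w ^+ 2 / (w - c) - l ^+ 2 * (w - c) =
    (g w - l * (w - c)) * ((g w - l * (w - c)) + 2 * l * (w - c)) / (w - c) by field.
move: wc0; rewrite -cabs_gt0 => k0.
rewrite cabsM cabsV ler_pdivrMr // cabsM.
have H2 : cabs ((g w - l * (w - c)) + 2 * l * (w - c)) <=
    (2 * cabs l + 1) * cabs (w - c).
  rewrite (le_trans (cabsD _ _)) // !cabsM cabs2.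
  by have := ler_wpM2r (ltW k0) e1_1; lra.
apply: le_trans (ler_pM (cabs_ge0 _) (cabs_ge0 _) H H2) _.
have -> : e1 * cabs (w - c) * ((2 * cabs l + 1) * cabs (w - c)) =
  (e1 * (2 * cabs l + 1)) * (cabs (w - c) * cabs (w - c)) by ring.
by rewrite -[X in _ <= X]mulrA ler_wpM2r // mulr_ge0 ?cabs_ge0.
Qed.

(** A Schwarz lemma for [g ^ 2]: the Cauchy estimate is applied to [g w ^+ 2 / (w - c)] at the
    centre [z], not [c]. *)
Lemma schwarz_sqrt g c s z : 0 < s ->
  (forall w, cabs (w - c) < s -> derivable g w 1 /\ cabs (g w) <= 1) ->
  g c = 0 -> cabs (z - c) <= s / 8 ->
  cabs (g z) ^+ 2 <= 8 / s * cabs (z - c).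
Proof.
move=> s0 Hg gc0 zc.
have [->|z_c] := eqVneq z c; first by rewrite gc0 subrr !cabs0 expr0n mulr0.
(* With radius [3 * s / 8] about [z], the annulus used by [cauchy_center] has distance at least
   [s / 4] from [c] and stays within [7 * s / 8] of it. *)
have s8 : 0 < 3 * s / 8 by lra.
have zc0 : 0 < cabs (z - c) by rewrite cabs_gt0 subr_eq0.
have tri w : cabs (w - c) <= cabs (w - z) + cabs (z - c).
  by rewrite (_ : w - c = (w - z) + (z - c)) ?cabsD //; ring.
have tri' w : cabs (w - z) <= cabs (w - c) + cabs (z - c).
  by rewrite (cabsB z) (_ : w - z = (w - c) + (c - z)) ?cabsD //; ring.
have /= := @cauchy_center R (fun w => g w ^+ 2 / (w - c)) z _ (4 / s) s8.
rewrite cabsM cabsV cabsX ler_pdivrMr //.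
have -> : 2 * (4 / s) * cabs (z - c) = 8 / s * cabs (z - c) by ring.
apply=> [w wz|w /andP[w1 w2]].
  have ws : cabs (w - c) < s by have := tri w; lra.
  have [->|w_c] := eqVneq w c.
    by apply: derivable_sqr_div => //; have [] := Hg c; rewrite ?subrr ?cabs0.
  apply: (@derivable_div_sub R (fun v => g v ^+ 2) c w w_c).
  have -> : (fun v => g v ^+ 2) = (fun v => g v * g v).
    by apply/funext => v; rewrite expr2.
  by have [dg _] := Hg w ws; exact: derivableM.
have wc : s / 4 <= cabs (w - c) by have := tri' w; lra.
have ws : cabs (w - c) < s by have := tri w; lra.
have [_ gw1] := Hg w ws.
rewrite cabsM cabsV cabsX ler_pdivrMr; last by lra.
apply: (@le_trans _ _ 1); first by rewrite expr_le1 ?cabs_ge0.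
apply: (@le_trans _ _ (4 / s * (s / 4))); last by rewrite ler_wpM2l // divr_ge0 // ltW.
by rewrite le_eqVlt; apply/orP; left; apply/eqP; field; rewrite gt_eqF.
Qed.

Lemma bounded_holo_dist f c s z M : 0 < s -> 0 < M ->
  (forall w, cabs (w - c) < s -> derivable f w 1 /\ cabs (f w) <= M) ->
  cabs (z - c) <= s / 8 ->
  cabs (f z - f c) ^+ 2 <= 32 * M ^+ 2 / s * cabs (z - c).
Proof.
move=> s0 M0 Hf zc.
have M2 : cabs (rc (2 * M)) = 2 * M by rewrite cabs_rc ger0_norm //; lra.
have fc : cabs (f c) <= M by have [] := Hf c; rewrite ?subrr ?cabs0.
have := @schwarz_sqrt (fun w => (f w - f c) * rc (2 * M)^-1) c s z s0.
rewrite cabsM rcV cabsV M2 exprMn exprVn => /(_ _ _ zc) H.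
have : cabs (f z - f c) ^+ 2 / (2 * M) ^+ 2 <= 8 / s * cabs (z - c).
  apply: H; last by rewrite subrr mul0r.
  move=> w /Hf[dfw fw]; split.
    apply: (derivableM _ (derivable_cst _ _ _)).
    exact: (derivableB dfw (derivable_cst (f c) w 1)).
  rewrite cabsM cabsV M2 ler_pdivrMr; last by lra.
  by rewrite (le_trans (cabsD _ _)) // cabsN; lra.
rewrite ler_pdivrMr ?exprn_gt0 //; last by lra.
by move=> /le_trans; apply; rewrite le_eqVlt; apply/orP; left; apply/eqP; ring.
Qed.

Definition cconj z : CC R := z^*%C.
Lemma cre_conj z : cre (cconj z) = cre z. Proof. by case: z. Qed.
Lemma cim_conj z : cim (cconj z) = - cim z. Proof. by case: z. Qed.
Lemma cabs_conj z : cabs (cconj z) = cabs z.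
Proof. by rewrite !cabsE cre_conj cim_conj sqrrN. Qed.

(** The Cayley transform of [F] that vanishes at [c] maps to the unit disk. For [|z - c| <= s / 32]
    the bound of [schwarz_sqrt] is [1 / 4], so the transform has modulus at most 1/2 at [z], and
    solving for [F z] gives the factor 3. *)
Lemma harnack_local F c s z : 0 < s ->
  (forall w, cabs (w - c) < s -> derivable F w 1 /\ 0 < cre (F w)) ->
  cabs (z - c) <= s / 32 -> cabs (F z) <= 3 * cabs (F c).
Proof.
move=> s0 HF zc.
have Fc0 : 0 < cre (F c) by have [] := HF c; rewrite ?subrr ?cabs0.
have den0 w : cabs (w - c) < s -> F w + cconj (F c) != 0.
  move=> /HF[_ Fw0]; apply/eqP => /(congr1 (@cre R)).
  by rewrite -rc0 !cE cre_conj; lra.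
have zs : cabs (z - c) < s by lra.
have := @schwarz_sqrt (fun w => (F w - F c) / (F w + cconj (F c))) c s z s0.
rewrite subrr mul0r => /(_ _ erefl) H.
have {}H : cabs ((F z - F c) / (F z + cconj (F c))) ^+ 2 <= (2^-1) ^+ 2.
  apply: le_trans (H _ _) _; last 2 first.
  - by lra.
  - apply: (@le_trans _ _ (8 / s * (s / 32))); first by rewrite ler_wpM2l // divr_ge0 // ltW.
    by rewrite le_eqVlt; apply/orP; left; apply/eqP; field; rewrite gt_eqF.
  move=> w ws; have [dF Fw0] := HF w ws; split.
    apply: derivableM.
      exact: (derivableB dF (derivable_cst (F c) w 1)).
    apply: derivableV; first exact: den0.
    exact: (derivableD dF (derivable_cst (cconj (F c)) w 1)).
  rewrite cabsM cabsV ler_pdivrMr ?cabs_gt0 ?den0 // mul1r.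
  rewrite -ler_sqr ?nnegrE ?cabs_ge0 // !sqr_cabs !cE cre_conj cim_conj.
  by have := mulr_gt0 Fw0 Fc0; lra.
have {}H : cabs ((F z - F c) / (F z + cconj (F c))) <= 2^-1.
  by rewrite -ler_sqr ?nnegrE ?cabs_ge0 ?invr_ge0.
move: H; rewrite cabsM cabsV ler_pdivrMr ?cabs_gt0 ?den0 // => H.
have := cabsD (F z) (cconj (F c)); rewrite cabs_conj.
have := cabsD (F z - F c) (F c); rewrite subrK.
by lra.
Qed.

(** A chain of [N.+1] equal steps from 0 to [z] along the radius, each costing a factor 3, so that
    [K] depends on [r] only. *)
Lemma harnack_disk r : 0 <= r < 1 -> exists K, forall F,
  (forall w, cabs w < 1 -> derivable F w 1 /\ 0 < cre (F w)) ->
  forall z, cabs z <= r -> cabs (F z) <= K * cabs (F 0).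
Proof.
move=> /andP[r0 r1].
(* Every point of the chain has a disk of radius [1 - r] around it inside the unit disk, so steps of
   length [(1 - r) / 32] are allowed. *)
have [N HN] : exists N, r * 32 / (1 - r) <= N.+1%:R.
  have := archi_boundP (_ : 0 <= r * 32 / (1 - r)).
  set N := Num.bound _ => HN; exists N; apply/ltW/(lt_le_trans (HN _)).
    by apply: divr_ge0; lra.
  by rewrite ler_nat.
exists (3 ^+ N.+1) => F HF z zr.
have N0 : 0 < N.+1%:R :> R by rewrite ltr0n.
pose u (j : nat) : CC R := rc (j%:R / N.+1%:R) * z.
have ur j : (j <= N.+1)%N -> cabs (u j) <= r.
  move=> jN; rewrite cabsM cabs_rc ger0_norm ?divr_ge0 ?ler0n //.
  apply: le_trans (zr); rewrite ler_piMl ?cabs_ge0 // ler_pdivrMr // mul1r ler_nat.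
  exact: jN.
suff H j : (j <= N.+1)%N -> cabs (F (u j)) <= 3 ^+ j * cabs (F 0).
  by have := H N.+1 (leqnn _); rewrite /u divff ?gt_eqF // rc1 mul1r.
elim: j => [_|j IH jN].
  by rewrite /u mul0r rc0 mul0r expr0 mul1r.
have {}IH := IH (ltnW jN).
rewrite exprS -mulrA; apply: (@le_trans _ _ (3 * cabs (F (u j)))); last first.
  by rewrite ler_wpM2l.
have uj := ur j (ltnW jN).
apply: (@harnack_local F (u j) (1 - r)); first by lra.
  move=> w wu; apply: HF.
  have := cabsD (w - u j) (u j); rewrite subrK; lra.
have -> : u j.+1 - u j = rc N.+1%:R^-1 * z.
  by rewrite /u -natr1 mulrDl rcD mul1r; ring.
rewrite cabsM cabs_rc ger0_norm ?invr_ge0 ?ler0n // mulrC ler_pdivrMr //.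
move: HN; rewrite ler_pdivrMr; last by lra.
by lra.
Qed.

End SchwarzHarnack.

(** * Characteristic polynomials and their roots *)
Section FunctionSubrings.
Variable R : realType.

(** Both derivability and continuity at a point are instances; polynomial expressions in matrix
    entries are thus treated once for both. *)
Definition fun_subring T (P : (T -> CC R) -> Prop) :=
  [/\ forall c, P (fun=> c),
      forall f g, P f -> P g -> P (fun x => f x + g x) &
      forall f g, P f -> P g -> P (fun x => f x * g x)].

Section Closure.
Variables (T : Type) (P : (T -> CC R) -> Prop).
Hypothesis subP : fun_subring P.

Lemma fun_subring_sum I (r : seq I) (Q : pred I) (F : I -> T -> CC R) :
  (forall i, Q i -> P (F i)) -> P (fun x => \sum_(i <- r | Q i) F i x).
Proof.
move=> PF; have [Pc PD _] := subP; elim: r => [|i r IH].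
  by rewrite (_ : (fun=> _) = fun=> 0); [exact: Pc|apply/funext => x; rewrite big_nil].
have [Qi|Qi] := boolP (Q i); last first.
  by congr P: IH; apply/funext => x; rewrite big_cons (negPf Qi).
by congr P: (PD _ _ (PF i Qi) IH); apply/funext => x; rewrite big_cons Qi.
Qed.

Lemma fun_subring_prod I (r : seq I) (F : I -> T -> CC R) :
  (forall i, P (F i)) -> P (fun x => \prod_(i <- r) F i x).
Proof.
move=> PF; have [Pc _ PM] := subP; elim: r => [|i r IH].
  by rewrite (_ : (fun=> _) = fun=> 1); [exact: Pc|apply/funext => x; rewrite big_nil].
by congr P: (PM _ _ (PF i) IH); apply/funext => x; rewrite big_cons.
Qed.

Lemma fun_subringN f : P f -> P (fun x => - f x).
Proof.
have [Pc _ PM] := subP => Pf; congr P: (PM _ _ (Pc (-1)) Pf).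
by apply/funext => x; rewrite mulN1r.
Qed.

Lemma fun_subringX f n : P f -> P (fun x => f x ^+ n).
Proof.
have [Pc _ PM] := subP => Pf; elim: n => [|n IH].
  by congr P: (Pc 1).
by congr P: (PM _ _ Pf IH); apply/funext => x; rewrite exprS.
Qed.

Lemma fun_subring_mulmx m n p (M : T -> 'M[CC R]_(m, n)) (N : T -> 'M[CC R]_(n, p)) :
  (forall i j, P (fun x => M x i j)) -> (forall i j, P (fun x => N x i j)) ->
  forall i j, P (fun x => (M x *m N x) i j).
Proof.
move=> PM PN i j; have [_ _ PMul] := subP.
rewrite (_ : (fun x => _) = fun x => \sum_k M x i k * N x k j); last first.
  by apply/funext => x; rewrite mxE.
by apply: fun_subring_sum => k _; exact: PMul.
Qed.

Lemma fun_subring_det n (M : T -> 'M[CC R]_n) :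
  (forall i j, P (fun x => M x i j)) -> P (fun x => \det (M x)).
Proof.
move=> PM; have [Pc _ PMul] := subP; apply: fun_subring_sum => s _.
by apply: PMul; [exact: Pc|apply: fun_subring_prod => i; exact: PM].
Qed.

Lemma fun_subring_adj n (M : T -> 'M[CC R]_n) :
  (forall i j, P (fun x => M x i j)) -> forall i j, P (fun x => (\adj (M x)) i j).
Proof.
move=> PM i j; have [Pc _ PMul] := subP.
rewrite (_ : (fun x => _) =
    fun x => (-1) ^+ (j + i) * \det (row' j (col' i (M x)))); last first.
  by apply/funext => x; rewrite mxE.
apply: PMul; first exact: Pc.
apply: fun_subring_det => a b.
by rewrite (_ : (fun x => _) = fun x => M x (lift j a) (lift i b)) //; apply/funext => x; rewrite !mxE.
Qed.

(** This determinant has polynomial entries, so closure is carried coefficientwise: [PP] holds for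
    families of polynomials all of whose coefficients satisfy [P]. *)
Lemma fun_subring_char_poly n (M : T -> 'M[CC R]_n) :
  (forall i j, P (fun x => M x i j)) -> forall k, P (fun x => (char_poly (M x))`_k).
Proof.
move=> PM; have [Pc PD PMul] := subP.
pose PP (F : T -> {poly CC R}) := forall k, P (fun x => (F x)`_k).
have PPM F G : PP F -> PP G -> PP (fun x => F x * G x).
  move=> PF PG k; rewrite (_ : (fun x => _) =
      fun x => \sum_(i < k.+1) (F x)`_i * (G x)`_(k - i)); last first.
    by apply/funext => x; rewrite coefM.
  by apply: fun_subring_sum => i _; apply: PMul; [exact: PF|exact: PG].
have PPprod I (r : seq I) (F : I -> T -> {poly CC R}) :
    (forall i, PP (F i)) -> PP (fun x => \prod_(i <- r) F i x).
  move=> PF; elim: r => [|i r IH].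
    move=> k; congr P: (Pc (1 : {poly CC R})`_k).
    by apply/funext => x; rewrite big_nil.
  congr PP: (PPM _ _ (PF i) IH).
  by apply/funext => x; rewrite big_cons.
move=> k; rewrite (_ : (fun x => _) = fun x => \sum_(s : 'S_n)
   ((-1) ^+ s * \prod_i char_poly_mx (M x) i (s i))`_k); last first.
  by apply/funext => x; rewrite coef_sum.
apply: fun_subring_sum => s _.
apply: (PPM (fun=> (-1) ^+ s) _ _ _ k); first by move=> j; exact: Pc.
apply: PPprod => i j.
rewrite (_ : (fun x => _) = fun x => ('X *+ (i == s i) : {poly CC R})`_j
     + (j == 0%N)%:R * - M x i (s i)); last first.
  apply/funext => x; rewrite !mxE coefB coefC.
  by case: (j == 0%N); rewrite ?mul1r ?mul0r ?subr0 ?addr0.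
by apply: PD; [exact: Pc|apply: PMul; [exact: Pc|exact: fun_subringN]].
Qed.

End Closure.

Lemma fun_subring_derivable (z : CC R) :
  fun_subring (fun f : CC R -> CC R => derivable f z 1).
Proof.
split=> [c|f g df dg|f g df dg]; first exact: derivable_cst.
  exact: derivableD.
exact: derivableM.
Qed.

Lemma fun_subring_continuous (T : topologicalType) (x : T) :
  fun_subring (fun f : T -> CC R => f y @[y --> x] --> f x).
Proof.
split=> [c|f g cf cg|f g cf cg].
- move=> Q QN; have Qc : Q c := @nbhs_singleton (CC R) c Q QN.
  have : \forall y \near x, Q c by apply: filterE.
  exact.
- exact: (cvgD cf cg).
- exact: (cvgM cf cg).
Qed.

Lemma derivable_sigma n (M : CC R -> 'M[CC R]_n) z :
  derivable M z 1 -> derivable (fun w => sigma (M w)) z 1.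
Proof.
move=> /derivable_mxCP dM; apply/derivable_mxCP => i j.
have [Pc _ PM] := fun_subring_derivable z.
rewrite (_ : (fun w => _) =
    fun w => (-1) ^+ j.+1 * (char_poly (M w))`_(n - j.+1)); last first.
  by apply/funext => w; rewrite mxE.
by apply: PM; [exact: Pc|exact: (fun_subring_char_poly (fun_subring_derivable z))].
Qed.

Lemma continuous_sigma n (A : 'M[CC R]_n) (e : R) : 0 < e ->
  exists2 d : R, 0 < d & forall X : 'M[CC R]_n, (forall i j, cabs (X i j - A i j) < d) ->
    forall j, cabs (sigma X 0 j - sigma A 0 j) < e.
Proof.
move=> e0; have subC := fun_subring_continuous A.
have [Pc _ PM] := subC.
pose g j (X : 'M[CC R]_n) : CC R := (-1) ^+ j.+1 * (char_poly X)`_(n - j.+1).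
have cg j : g j X @[X --> A] --> g j A.
  apply: (PM (fun=> (-1) ^+ j.+1) (fun X => (char_poly X)`_(n - j.+1)) (Pc _)).
  apply: (fun_subring_char_poly subC) => a b.
  move=> Q /nbhs_CCP[d d0 dQ]; apply/nbhs_mxP; exists d => // X AX.
  exact: dQ.
have : \forall X \near A, forall j : 'I_n, cabs (g j X - g j A) < e.
  have FA : Filter (nbhs A) by exact: nbhs_filter.
  apply: (@filter_forall _ _ _ _ FA) => j.
  apply: (cg j [set w | cabs (w - g j A) < e]).
  by apply/nbhs_CCP; exists e.
move=> /nbhs_mxP[d d0 dg]; exists d => // X AX j.
by have := dg X AX j; rewrite /g !mxE.
Qed.

End FunctionSubrings.

(** * Monic polynomials, their roots and the two domains *)

Section RootsSpoly.
Variable R : realType.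
Implicit Types (z w t : CC R) (x e r rho : R).

(** The monic polynomial whose roots have the entries of [c] as elementary symmetric functions. *)
Definition spoly n (c : 'rV[CC R]_n) : {poly CC R} :=
  'X^n + \sum_(j < n) ((-1) ^+ j.+1 * c 0 j) *: 'X^(n - j.+1).

Lemma size_spoly_tail n (c : 'rV[CC R]_n) :
  (size (\sum_(j < n) ((-1) ^+ j.+1 * c 0 j) *: 'X^(n - j.+1) : {poly CC R})%R <= n)%N.
Proof.
apply: (leq_trans (size_sum _ _ _)); apply/bigmax_leqP => j _.
apply: (leq_trans (size_scale_leq _ _)).
by rewrite size_polyXn ltn_subrL (leq_ltn_trans _ (ltn_ord j)).
Qed.

Lemma size_spoly n (c : 'rV[CC R]_n) : size (spoly c) = n.+1.
Proof. by rewrite /spoly size_polyDl size_polyXn // ltnS size_spoly_tail. Qed.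

Lemma monic_spoly n (c : 'rV[CC R]_n) : spoly c \is monic.
Proof.
rewrite monicE /spoly lead_coefDl ?lead_coefXn //.
by rewrite size_polyXn ltnS size_spoly_tail.
Qed.

Lemma coef_spoly n (c : 'rV[CC R]_n) (j : 'I_n) :
  (spoly c)`_(n - j.+1) = (-1) ^+ j.+1 * c 0 j.
Proof.
have ltn_n : (n - j.+1 < n)%N by rewrite ltn_subrL (leq_ltn_trans _ (ltn_ord j)).
rewrite coefD coefXn (ltn_eqF ltn_n) add0r coef_sum (bigD1 j) //= big1 ?addr0.
  by rewrite coefZ coefXn eqxx mulr1.
move=> i ij; rewrite coefZ coefXn; case: eqP => [E|]; last by rewrite mulr0.
case/eqP: ij; apply/val_inj => /=; have := ltn_ord i; have := ltn_ord j.
by move: E; move: (nat_of_ord i) (nat_of_ord j) => a b E; move: E; lia.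
Qed.

Lemma spoly_sigma n (A : 'M[CC R]_n) : spoly (sigma A) = char_poly A.
Proof.
have mono := char_poly_monic A; have sz := size_char_poly A.
apply/polyP => k; have [kn|nk|->] := ltngtP k n.
- have kE : k = (n - (rev_ord (Ordinal kn)).+1)%N.
    by rewrite /=; move: kn; lia.
  rewrite kE coef_spoly mxE mulrA -exprD -signr_odd addnn odd_double mul1r.
  by rewrite -kE.
- by rewrite !nth_default // ?size_spoly ?sz.
- have := monicP (monic_spoly (sigma A)); have := monicP mono.
  by rewrite !lead_coefE size_spoly sz /= => -> ->.
Qed.

Lemma monic_split (p : {poly CC R}) : p \is monic ->
  exists rs : seq (CC R), p = \prod_(z <- rs) ('X - z%:P).
Proof.
move=> /monicP p1; have [rs E] := @closed_field_poly_normal R[i] p.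
by exists rs; rewrite {1}E p1 scale1r.
Qed.

Lemma root_split (rs : seq (CC R)) z :
  root (\prod_(w <- rs) ('X - w%:P)) z = (z \in rs).
Proof. exact: root_prod_XsubC. Qed.

Lemma size_split n (p : {poly CC R}) (rs : seq (CC R)) : size p = n.+1 ->
  p = \prod_(z <- rs) ('X - z%:P) -> size rs = n.
Proof. by move=> + E; rewrite E size_prod_XsubC => -[]. Qed.

Lemma finite_bound (rs : seq (CC R)) : (forall z, z \in rs -> cabs z < 1) ->
  exists2 rho : R, 0 < rho < 1 & forall z, z \in rs -> cabs z <= rho.
Proof.
elim: rs => [|z rs IH] Hz; first by exists 2^-1 => //; lra.
have [w wrs|rho rhoI Hrho] := IH; first by apply: Hz; rewrite inE wrs orbT.
have z1 := Hz z (mem_head _ _).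
exists (Num.max rho (cabs z)) => [|w].
  by case/andP: rhoI => r0 r1; rewrite lt_max r0 gt_max r1.
by rewrite inE le_max => /orP[/eqP ->|/Hrho ->]; rewrite ?lexx ?orbT.
Qed.

Definition roots_le n (c : 'rV[CC R]_n) (rho : R) :=
  forall z, root (spoly c) z -> cabs z <= rho.

Definition roots_lt1 n (c : 'rV[CC R]_n) := forall z, root (spoly c) z -> cabs z < 1.

Lemma roots_lt1_le n (c : 'rV[CC R]_n) : roots_lt1 c ->
  exists2 rho : R, 0 < rho < 1 & roots_le c rho.
Proof.
move=> Hc; have [rs E] := monic_split (monic_spoly c).
have [z zrs|rho rhoI Hrho] := @finite_bound rs.
  by apply: Hc; rewrite E root_split.
by exists rho => // z; rewrite E root_split; exact: Hrho.
Qed.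

Lemma spectral_ballP n (A : 'M[CC R]_n) : (0 < n)%N ->
  spectral_ball R n A <-> roots_lt1 (sigma A).
Proof.
move=> n0; rewrite /spectral_ball /= /spectral_radius /roots_lt1 spoly_sigma.
have [rs E] := monic_split (char_poly_monic A).
have rs0 : exists a, a \in rs.
  have := size_split (size_char_poly A) E; case: (rs) => [|a s _]; first by move=> n0'; rewrite -n0' in n0.
  by exists a; exact: mem_head.
have eigE a : eigenvalue A a = (a \in rs) by rewrite eigenvalue_root_char E root_split.
have bnd : exists M, forall z, z \in rs -> cabs z <= M.
  elim: (rs) => [|z s [M HM]]; first by exists 0.
  exists (Num.max M (cabs z)) => w.
  by rewrite inE le_max => /orP[/eqP ->|/HM ->]; rewrite ?lexx ?orbT.
split=> [H z|H].
  rewrite E root_split => zrs; apply: le_lt_trans H; apply: ub_le_sup.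
    by have [M HM] := bnd; exists M => x [w /=]; rewrite eigE => /HM ? <-.
  by exists z => //=; rewrite eigE.
have [z zrs|rho /andP[_ rho1] Hrho] := @finite_bound rs; first by apply: H; rewrite E root_split.
apply: le_lt_trans rho1; apply: ge_sup.
  by have [a ars] := rs0; exists (cabs a), a => //=; rewrite eigE.
by move=> x [w /=]; rewrite eigE => /Hrho ? <-.
Qed.

(** Quantitative openness, with [e] independent of [c]. Suppose that [z] is a root of [spoly c']
    with [|z| >= rho]. Every factor of [spoly c] at [z] has modulus at least
    [(1 - rho0 / rho) * |z|], while [(spoly c).[z]] is the difference of the two polynomials at [z],
    at most [n * e * (|z| / rho) ^ n]. The choice of [e] leaves the contradiction
    [1 <= n / (n + 1)]. *)
Lemma roots_open n rho0 rho : 0 <= rho0 -> rho0 < rho -> rho <= 1 ->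
  exists2 e, 0 < e & forall c c' : 'rV[CC R]_n, roots_le c rho0 ->
    (forall j, cabs (c' 0 j - c 0 j) <= e) ->
    forall z, root (spoly c') z -> cabs z < rho.
Proof.
move=> rho00 rho_lt rho_1; have rho_gt0 : 0 < rho by lra.
have nn : 0 < n.+1%:R :> R by rewrite ltr0n.
have d0 : 0 < rho - rho0 by lra.
exists ((rho - rho0) ^+ n / n.+1%:R) => [|c c' Hc cc' z /rootP zr].
  by rewrite divr_gt0 ?exprn_gt0.
rewrite ltNge; apply/negP => rz; have z0 : 0 < cabs z by lra.
have [rs E] := monic_split (monic_spoly c).
have srs := size_split (size_spoly c) E.
have lower : ((1 - rho0 / rho) * cabs z) ^+ n <= cabs (spoly c).[z].
  rewrite E horner_prod cabs_prod -srs.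
  have : forall w, w \in rs -> cabs w <= rho0 by move=> w wrs; apply: Hc; rewrite E root_split.
  have k0 : 0 <= (1 - rho0 / rho) * cabs z.
    by apply: mulr_ge0; [rewrite subr_ge0 ler_pdivrMr // mul1r ltW|exact: ltW].
  elim: (rs) => [_|w s IH Hs]; first by rewrite expr0 big_nil.
  rewrite exprS big_cons; apply: ler_pM => //; first by rewrite exprn_ge0.
    rewrite !hornerE; have := cabsD (z - w) w; rewrite subrK.
    have := Hs w (mem_head _ _).
    have : rho0 <= rho0 / rho * cabs z by rewrite mulrAC ler_pdivlMr // ler_wpM2l.
    lra.
  by apply: IH => v vs; apply: Hs; rewrite inE vs orbT.
have upper : cabs (spoly c).[z] <= n%:R * ((rho - rho0) ^+ n / n.+1%:R) * (cabs z / rho) ^+ n.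
  have -> : (spoly c).[z] = \sum_(j < n) ((-1) ^+ j.+1 * (c 0 j - c' 0 j)) * z ^+ (n - j.+1).
    transitivity ((spoly c).[z] - (spoly c').[z]); first by rewrite zr subr0.
    rewrite /spoly !hornerE !horner_sum opprD addrACA subrr add0r -sumrB.
    by apply: eq_bigr => j _; rewrite !hornerE; ring.
  apply: le_trans (cabs_sum _ _) _.
  have -> : n%:R * ((rho - rho0) ^+ n / n.+1%:R) * (cabs z / rho) ^+ n =
    \sum_(j < n) ((rho - rho0) ^+ n / n.+1%:R) * (cabs z / rho) ^+ n.
    by rewrite sumr_const card_ord -mulrA mulr_natl.
  apply: ler_sum => j _; rewrite !cabsM !cabsX cabsN cabs1 expr1n mul1r.
  apply: ler_pM; rewrite ?cabs_ge0 ?exprn_ge0 ?cabs_ge0 //.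
    by rewrite cabsB.
  have zr1 : 1 <= cabs z / rho by rewrite ler_pdivlMr // mul1r.
  apply: (@le_trans _ _ ((cabs z / rho) ^+ (n - j.+1))).
    rewrite lerXn2r ?nnegrE ?cabs_ge0 ?divr_ge0 ?cabs_ge0 ?(ltW rho_gt0) //.
    by rewrite ler_pdivlMr // ler_piMr ?cabs_ge0.
  by rewrite ler_weXn2l // leq_subr.
have : ((1 - rho0 / rho) * cabs z) ^+ n <= n%:R / n.+1%:R * ((1 - rho0 / rho) * cabs z) ^+ n.
  apply: le_trans lower (le_trans upper _).
  have -> : (1 - rho0 / rho) * cabs z = (rho - rho0) * (cabs z / rho).
    by field; rewrite gt_eqF.
  by rewrite [((rho - rho0) * _) ^+ n]exprMn le_eqVlt; apply/orP; left; apply/eqP; ring.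
have k0 : 0 < ((1 - rho0 / rho) * cabs z) ^+ n.
  by rewrite exprn_gt0 // mulr_gt0 // subr_gt0 ltr_pdivrMr // mul1r.
by rewrite -[X in X <= _]mul1r ler_pM2r // ler_pdivlMr // mul1r ler_nat ltnn.
Qed.

End RootsSpoly.

(** * Companion matrices and the uniform margin in the polydisk *)

Section PolydiskGeometry.
Variable R : realType.
Implicit Types (z w t : CC R) (x y e r rho : R).

Lemma cast_companion n (c : 'rV[CC R]_n) : (size (spoly c)).-1 = n.
Proof. by rewrite size_spoly. Qed.

(** The dimension of [companionmx p] is computed from [size p]; the cast turns it into [n]. *)
Definition companion n (c : 'rV[CC R]_n) : 'M[CC R]_n :=
  castmx (cast_companion c, cast_companion c) (companionmx (spoly c)).

Lemma companionE n (c : 'rV[CC R]_n) i j : companion c i j =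
  if i == n.-1 :> nat then - (spoly c)`_j else (i.+1 == j :> nat)%:R.
Proof. by rewrite castmxE mxE /= size_spoly. Qed.

Lemma char_poly_companion n (c : 'rV[CC R]_n) : char_poly (companion c) = spoly c.
Proof.
rewrite /companion; move: (cast_companion c) (monic_spoly c).
move: (spoly c) => p e pm; case: _ / e.
by rewrite castmx_id companionmxK.
Qed.

Lemma sigma_inj_char_poly n (A : 'M[CC R]_n) c : char_poly A = spoly c -> sigma A = c.
Proof.
move=> E; apply/rowP => j; rewrite mxE E coef_spoly mulrA -exprD -signr_odd addnn.
by rewrite odd_double mul1r.
Qed.

Lemma sigma_companion n (c : 'rV[CC R]_n) : sigma (companion c) = c.
Proof. by apply: sigma_inj_char_poly; exact: char_poly_companion. Qed.

Lemma symmetrized_polydiskP n (c : 'rV[CC R]_n) : (0 < n)%N ->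
  symmetrized_polydisk R n c <-> roots_lt1 c.
Proof.
move=> n0; split=> [[A /spectral_ballP-/(_ n0) HA <-] //|Hc].
by exists (companion c); [apply/spectral_ballP; rewrite // sigma_companion|exact: sigma_companion].
Qed.

Lemma coef_prod_le (rs : seq (CC R)) k : (forall z, z \in rs -> cabs z <= 1) ->
  cabs (\prod_(z <- rs) ('X - z%:P))`_k <= 2 ^+ size rs.
Proof.
elim: rs k => [|z rs IH] k Hz.
  by rewrite big_nil coefC expr0; case: eqP => _; [rewrite cabs1|rewrite cabs0 ler01].
have {}IH j : cabs (\prod_(z <- rs) ('X - z%:P))`_j <= 2 ^+ size rs.
  by apply: IH => w wrs; apply: Hz; rewrite inE wrs orbT.
rewrite big_cons mulrC mulrBr coefB coefMC coefMX exprS.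
rewrite (le_trans (cabsD _ _)) // cabsN cabsM -[2]/(1 + 1 : R) mulrDl !mul1r.
apply: lerD; first by case: eqP => _ //; rewrite cabs0 exprn_ge0.
by rewrite -[X in _ <= X]mulr1; apply: ler_pM; rewrite ?cabs_ge0 ?Hz ?mem_head.
Qed.

Lemma roots_lt1_bounded n (c : 'rV[CC R]_n) j : roots_lt1 c -> cabs (c 0 j) <= 2 ^+ n.
Proof.
move=> Hc; have [rs E] := monic_split (monic_spoly c).
have srs := size_split (size_spoly c) E.
have -> : cabs (c 0 j) = cabs (spoly c)`_(n - j.+1).
  by rewrite coef_spoly cabsM cabsX cabsN cabs1 expr1n mul1r.
rewrite E -[X in 2 ^+ X]srs; apply: coef_prod_le => z zrs; apply/ltW/Hc.
by rewrite E root_split.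
Qed.

Lemma horner_deriv_prod (rs : seq (CC R)) t : t \notin rs ->
  (\prod_(z <- rs) ('X - z%:P))^`().[t] =
  (\prod_(z <- rs) ('X - z%:P)).[t] * \sum_(z <- rs) (t - z)^-1.
Proof.
elim: rs => [|z rs IH]; first by rewrite !big_nil derivC horner0 mulr0.
rewrite inE negb_or => /andP[tz /IH {}IH].
rewrite !big_cons derivM derivXsubC mul1r !hornerE IH.
by field; rewrite subr_eq0.
Qed.

Lemma fun_subring_coef_spoly T (P : (T -> CC R) -> Prop) n (phi : T -> 'rV[CC R]_n) k :
  fun_subring P -> (forall j, P (fun v => phi v 0 j)) -> P (fun v => (spoly (phi v))`_k).
Proof.
move=> subP Pphi; have [Pc PD PM] := subP.
rewrite (_ : (fun v => _) = fun v => ('X^n : {poly CC R})`_k +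
  \sum_(j < n) (((-1) ^+ j.+1 * ('X^(n - j.+1) : {poly CC R})`_k) * phi v 0 j)); last first.
  apply/funext => v; rewrite coefD coef_sum; congr (_ + _); apply: eq_bigr => j _.
  by rewrite coefZ mulrAC.
apply: PD; first exact: Pc.
by apply: (fun_subring_sum subP) => j _; apply: PM; [exact: Pc|exact: Pphi].
Qed.

Lemma cre_inv_gt0 z : cabs z < 1 -> 0 < cre (1 - z)^-1.
Proof.
move=> z1; rewrite creV divr_gt0 //.
  by rewrite -rc1 !cE; have := cre_le_cabs z; lra.
rewrite exprn_gt0 // cabs_gt0 subr_eq0; apply/eqP => E.
by move: z1; rewrite -E cabs1 ltxx.
Qed.

Definition logder n (c : 'rV[CC R]_n) t := t * ((spoly c)^`()).[t] / (spoly c).[t].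

Lemma logderE n (c : 'rV[CC R]_n) t (rs : seq (CC R)) :
  spoly c = \prod_(z <- rs) ('X - z%:P) -> roots_lt1 c -> cabs t = 1 ->
  logder c t = \sum_(z <- rs) (1 - z / t)^-1.
Proof.
move=> E Hc t1; have trs : t \notin rs.
  by apply/negP => trs; have := Hc t; rewrite E root_split t1 ltxx => /(_ trs).
have t0 : t != 0 by rewrite -cabs_gt0 t1.
have p0 : (\prod_(z <- rs) ('X - z%:P)).[t] != 0 by rewrite -/(root _ t) root_split.
rewrite /logder E horner_deriv_prod // mulrCA mulrAC divff // mul1r mulr_sumr.
apply: eq_big_seq => z zrs; have tz : t - z != 0.
  by rewrite subr_eq0; apply: contra trs => /eqP ->.
by field; rewrite tz t0.
Qed.

Lemma cre_sum I (s : seq I) (F : I -> CC R) :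
  cre (\sum_(i <- s) F i) = \sum_(i <- s) cre (F i).
Proof.
by elim: s => [|i s IH]; rewrite ?big_nil ?big_cons ?creD ?IH.
Qed.

(* The real parts of the summands [(1 - z / t)^-1] are positive, so each root
   [z] is controlled by [logder c (z / `|z|)], whose own growth in a holomorphic
   parameter is controlled by Harnack's inequality. *)
Lemma logder_ge n (c : 'rV[CC R]_n) z : roots_lt1 c -> root (spoly c) z -> z != 0 ->
  (1 - cabs z)^-1 <= cabs (logder c (z / rc (cabs z))).
Proof.
move=> Hc rz z0; have [rs E] := monic_split (monic_spoly c).
have zc0 : 0 < cabs z by rewrite cabs_gt0.
set t := z / _; have t1 : cabs t = 1.
  by rewrite cabsM cabsV cabs_rc ger0_norm ?cabs_ge0 // divff // gt_eqF.
have t0 : t != 0 by rewrite -cabs_gt0 t1.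
rewrite (logderE E Hc t1); apply: le_trans (cre_le_cabs _).
have zrs : z \in rs by rewrite -root_split -E.
rewrite (perm_big _ (perm_to_rem zrs)) big_cons creD /=.
have -> : z / t = rc (cabs z).
  have rz0 : rc (cabs z) != 0 by rewrite -cabs_gt0 cabs_rc gtr0_norm.
  by rewrite /t; field; rewrite z0 rz0.
rewrite -rc1 -rcN -rcD -rcV cre_rc lerDl cre_sum.
rewrite big_seq; apply: sumr_ge0 => w wrs; apply/ltW/cre_inv_gt0.
rewrite cabsM cabsV t1 invr1 mulr1; apply: Hc.
by rewrite E root_split; exact: mem_rem wrs.
Qed.

Lemma logder_le n (c : 'rV[CC R]_n) rho t : roots_le c rho -> rho < 1 -> cabs t = 1 ->
  cabs (logder c t) <= n%:R / (1 - rho).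
Proof.
move=> Hc rho1 t1; have [rs E] := monic_split (monic_spoly c).
have Hc1 : roots_lt1 c by move=> z /Hc /le_lt_trans; exact.
rewrite (logderE E Hc1 t1) (le_trans (cabs_sum _ _)) //.
have srs := size_split (size_spoly c) E.
have Hrs w : w \in rs -> cabs w <= rho by move=> wrs; apply: Hc; rewrite E root_split.
rewrite -srs; elim: (rs) Hrs => [_|w s IH Hs]; first by rewrite big_nil mul0r.
rewrite big_cons /= -natr1 mulrDl addrC mul1r; apply: lerD.
  by apply: IH => v vs; apply: Hs; rewrite inE vs orbT.
have wr := Hs w (mem_head _ _); have wt : cabs (w / t) = cabs w by rewrite cabsM cabsV t1 invr1 mulr1.
rewrite cabsV; have := cabsD (1 - w / t) (w / t); rewrite subrK cabs1 wt => H.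
by rewrite lef_pV2 ?posrE; lra.
Qed.

Lemma cre_logder_gt0 n (c : 'rV[CC R]_n) t : (0 < n)%N -> roots_lt1 c -> cabs t = 1 ->
  0 < cre (logder c t).
Proof.
move=> n0 Hc t1; have [rs E] := monic_split (monic_spoly c).
rewrite (logderE E Hc t1) cre_sum.
have srs := size_split (size_spoly c) E.
have Hrs w : w \in rs -> 0 < cre (1 - w / t)^-1.
  move=> wrs; apply: cre_inv_gt0; rewrite cabsM cabsV t1 invr1 mulr1; apply: Hc.
  by rewrite E root_split.
case: (rs) srs Hrs n0 => [<- //|w s _ Hs _].
rewrite big_cons; apply: ltr_pwDl; first by apply: Hs; exact: mem_head.
by rewrite big_seq; apply: sumr_ge0 => v vs; apply/ltW/Hs; rewrite inE vs orbT.
Qed.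

Lemma derivable_logder n (phi : CC R -> 'rV[CC R]_n) w t :
  derivable phi w 1 -> (spoly (phi w)).[t] != 0 ->
  derivable (fun v => logder (phi v) t) w 1.
Proof.
move=> /derivable_mxCP dphi p0; have subD := fun_subring_derivable w.
have [Pc PD PM] := subD.
have Pcoef k : derivable (fun v => (spoly (phi v))`_k) w 1.
  exact: (fun_subring_coef_spoly k subD (dphi 0)).
have PH : derivable (fun v => (spoly (phi v)).[t]) w 1.
  rewrite (_ : (fun v => _) = fun v => \sum_(k < n.+1) (spoly (phi v))`_k * t ^+ k).
    by apply: (fun_subring_sum subD) => k _; apply: PM; [exact: Pcoef|exact: Pc].
  by apply/funext => v; rewrite (@horner_coef_wide _ n.+1) // size_spoly.
have PH' : derivable (fun v => ((spoly (phi v))^`()).[t]) w 1.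
  rewrite (_ : (fun v => _) = fun v => \sum_(k < n.+1) ((spoly (phi v))`_k.+1 * k.+1%:R) * t ^+ k).
    apply: (fun_subring_sum subD) => k _; apply: (PM _ _ _ (Pc _)).
    by apply: PM; [exact: Pcoef|exact: Pc].
  apply/funext => v; rewrite (@horner_coef_wide _ n.+1).
    by apply: eq_bigr => k _; rewrite coef_deriv mulr_natr.
  by rewrite (leq_trans (size_poly _ _)) // size_spoly.
apply: (PM); first by apply: PM; [exact: Pc|exact: PH'].
exact: derivableV.
Qed.

(** The uniform margin: [rho'] does not depend on [phi]. For a root [z] of [spoly (phi w)] the point
    [t = z / |z|] is frozen and Harnack is applied to [v |-> logder (phi v) t]. This bounds
    [1 / (1 - |z|)] by [K * n / (1 - rho)]. *)
Lemma roots_contract n r rho : (0 < n)%N -> 0 <= r < 1 -> rho < 1 ->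
  exists2 rho', 0 <= rho' < 1 & forall phi : CC R -> 'rV[CC R]_n,
    holo_disk (@roots_lt1 R n) phi -> roots_le (phi 0) rho ->
    forall w, cabs w <= r -> roots_le (phi w) rho'.
Proof.
move=> n0 rI rho1; have [K HK] := harnack_disk rI.
(* The absolute value covers a negative [K], and adding 1 puts [1 - M^-1] into [[0, 1)]. *)
pose M := `|K * (n%:R / (1 - rho))| + 1.
have M1 : 1 <= M by rewrite lerDr normr_ge0.
have Minv : 0 < M^-1 <= 1.
  by rewrite invr_gt0 (lt_le_trans ltr01 M1) invf_le1 // (lt_le_trans ltr01 M1).
exists (1 - M^-1) => [|phi Hphi phi0 w wr z rz]; first by lra.
have [->|z0] := eqVneq z 0; first by rewrite cabs0; lra.
have w1 : unit_disk w by rewrite /unit_disk /=; case/andP: rI => _; exact: le_lt_trans.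
have [Hw _] := Hphi w w1.
have t1 : cabs (z / rc (cabs z)) = 1.
  by rewrite cabsM cabsV cabs_rc ger0_norm ?cabs_ge0 // divff // gt_eqF // cabs_gt0.
have := logder_ge Hw rz z0; set t := z / rc (cabs z) => Hge.
have := HK (fun v => logder (phi v) t) _ w wr => /= HK'.
have {}HK' : cabs (logder (phi w) t) <= K * cabs (logder (phi 0) t).
  apply: HK' => v v1; have [Hv dv] := Hphi v v1; split; last exact: cre_logder_gt0.
  apply: derivable_logder dv _; apply/negP => /Hv.
  by rewrite t1 ltxx.
have H0 := logder_le phi0 rho1 t1.
have K0 : 0 <= cabs (logder (phi 0) t) by exact: cabs_ge0.
have HM : (1 - cabs z)^-1 <= M.
  apply: le_trans Hge (le_trans HK' _); rewrite /M.
  have n1 : 0 <= n%:R / (1 - rho) by apply: divr_ge0; rewrite ?ler0n //; lra.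
  have [k0|k0] := leP 0 K.
    have kn0 : 0 <= K * (n%:R / (1 - rho)) by exact: mulr_ge0.
    rewrite (ger0_norm kn0).
    by have := ler_wpM2l k0 H0; lra.
  have := mulr_le0_ge0 (ltW k0) K0; have := normr_ge0 (K * (n%:R / (1 - rho))); lra.
have z1 := Hw _ rz.
have : (M)^-1 <= 1 - cabs z.
  rewrite -[X in _ <= X]invrK lef_pV2 ?posrE ?invr_gt0 //; last by lra.
  exact: lt_le_trans M1.
lra.
Qed.

End PolydiskGeometry.

(** * Semicontinuity of Lempert functions *)
Section Lempert.
Variable R : realType.
Implicit Types (z w t : CC R) (x y e r rho d : R).

Definition joined (V : normedModType (CC R)) (D : set V) (a b : V) (alpha : CC R) :=
  unit_disk alpha /\ exists phi, [/\ holo_disk D phi, phi 0 = a & phi alpha = b].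

Lemma lempert_ge0 (V : normedModType (CC R)) (D : set V) a b : 0 <= lempert D a b.
Proof.
have [[x Sx]|S0] := pselect (exists x, [set cabs al | al in [set al | joined D a b al]] x).
  by apply: lb_le_inf; [exists x|move=> _ [z _ <-]; exact: cabs_ge0].
rewrite /lempert (_ : [set _ | _ in _] = set0) ?inf0 //.
by rewrite -subset0 => x Sx; apply: S0; exists x.
Qed.

Lemma lempert_le (V : normedModType (CC R)) (D : set V) a b alpha :
  joined D a b alpha -> lempert D a b <= cabs alpha.
Proof.
move=> J; apply: ge_inf; last by exists alpha.
by exists 0 => _ [z _ <-]; exact: cabs_ge0.
Qed.

Lemma lempert_le1 (V : normedModType (CC R)) (D : set V) a b : lempert D a b <= 1.
Proof.
have [[alpha J]|nJ] := pselect (exists alpha, joined D a b alpha).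
  by apply: le_trans (lempert_le J) _; case: J => /ltW.
rewrite /lempert (_ : [set _ | _ in _] = set0) ?inf0 //.
by rewrite -subset0 => x [z J _]; apply: nJ; exists z.
Qed.

Lemma lempert_lt (V : normedModType (CC R)) (D : set V) a b e :
  (exists alpha, joined D a b alpha) -> 0 < e ->
  exists2 alpha, joined D a b alpha & cabs alpha < lempert D a b + e.
Proof.
move=> [alpha J] e0.
have hi : has_inf [set cabs a0 | a0 in [set a0 | joined D a b a0]].
  split; first by exists (cabs alpha), alpha.
  by exists 0 => _ [z _ <-]; exact: cabs_ge0.
have [_ [beta Jb <-] lt_e] := inf_adherent e0 hi.
by exists beta.
Qed.

Lemma derivable_comp_mul m n (phi : CC R -> 'M[CC R]_(m, n)) k w :
  derivable phi (k * w) 1 -> derivable (fun v => phi (k * v)) w 1.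
Proof.
move=> /derivable1_diffP dphi; apply/derivable1_diffP.
have /derivable1_diffP dk := derivableM (derivable_cst k w 1) (@derivable_id _ (CC R) w 1).
exact: (differentiable_comp dk dphi).
Qed.

Lemma derivable_affine m n (A B : 'M[CC R]_(m, n)) z :
  derivable (fun w => A + w *: B) z 1.
Proof.
apply/derivable_mxCP => i j; have [Pc PD PM] := fun_subring_derivable z.
rewrite (_ : (fun w => _) = fun w => A i j + w * B i j); last first.
  by apply/funext => w; rewrite !mxE.
by apply: (PD); [exact: Pc|apply: PM; [exact: derivable_id|exact: Pc]].
Qed.

(* A disk that stays away from the boundary of [D] can be pushed to nearby end
   points by adding a small affine correction. *)
Lemma perturb_disk m n (D : set 'M[CC R]_(m, n)) (phi : CC R -> 'M[CC R]_(m, n)) r (alpha : CC R)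
  d d' (a' b' : 'M[CC R]_(m, n)) :
  0 < r <= 1 -> alpha != 0 -> cabs alpha < r ->
  (forall w, unit_disk w -> derivable phi w 1) ->
  (forall w (X : 'M[CC R]_(m, n)), cabs w <= r -> (forall i j, cabs (X i j - phi w i j) <= d') -> D X) ->
  (forall i j, cabs (a' i j - phi 0 i j) <= d) ->
  (forall i j, cabs (b' i j - phi alpha i j) <= d) ->
  0 <= d -> d * (1 + 2 / cabs alpha) <= d' ->
  joined D a' b' (alpha / rc r).
Proof.
move=> /andP[r0 r1] al0 al_r dphi HD Ha Hb d0 dd'.
have rc_r : rc r != 0 by rewrite -cabs_gt0 cabs_rc gtr0_norm.
have cr : cabs (rc r) = r by rewrite cabs_rc gtr0_norm.
have ca0 : 0 < cabs alpha by rewrite cabs_gt0.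
split; first by rewrite /unit_disk /= cabsM cabsV cr ltr_pdivrMr // mul1r.
pose u := a' - phi 0; pose v := b' - phi alpha.
(* The affine term equals [u] at 0 and [v] at [alpha / r]. On the disk its entries are at most
   [d + 2 * d / |alpha|]. *)
exists (fun w => phi (rc r * w) + (u + w *: ((rc r / alpha) *: (v - u)))).
split; last 2 first.
- by rewrite mulr0 scale0r addr0 /u addrC subrK.
- rewrite (_ : rc r * (alpha / rc r) = alpha); last by field.
  rewrite scalerA (_ : alpha / rc r * (rc r / alpha) = 1); last by field; rewrite rc_r al0.
  by rewrite scale1r [u + _]addrC subrK /v addrC subrK.
move=> w w1; have rw : cabs (rc r * w) <= r.
  by rewrite cabsM cr ler_piMr ?(ltW r0) //; exact: ltW.
split; last first.
  apply: derivableD; last exact: derivable_affine.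
  apply: derivable_comp_mul; apply: dphi; rewrite /unit_disk /= cabsM cr.
  apply: le_lt_trans (w1 : cabs w < 1); rewrite ler_piMl ?cabs_ge0 //.
apply: (HD (rc r * w)) => // i j.
rewrite mxE addrAC subrr add0r !mxE.
have uij : cabs (u i j) <= d by rewrite !mxE; exact: Ha.
have vij : cabs (v i j) <= d by rewrite !mxE; exact: Hb.
move: uij vij; rewrite !mxE; move: (a' i j - phi 0 i j) (b' i j - phi alpha i j) => p q p_d q_d.
apply: le_trans (cabsD _ _) _; apply: le_trans dd'; rewrite [X in _ <= X]mulrDr mulr1; apply: lerD => //.
rewrite !cabsM cabsV cr mulrA.
have H1 : cabs w * (r / cabs alpha) <= (cabs alpha)^-1.
  rewrite mulrA -[X in _ <= X]mul1r ler_wpM2r ?invr_ge0 ?cabs_ge0 //.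
  by rewrite mulr_ile1 ?cabs_ge0 ?(ltW r0) //; exact: ltW.
have H2 : cabs (q - p) <= 2 * d by have := cabsD q (- p); rewrite cabsN; lra.
rewrite mulrAC [X in X <= _](_ : _ = cabs w * (r / cabs alpha) * cabs (q - p)); last by ring.
have := ler_pM _ (cabs_ge0 _) H1 H2.
rewrite (_ : d * (2 / cabs alpha) = (cabs alpha)^-1 * (2 * d)); last by ring.
by apply; rewrite mulr_ge0 ?cabs_ge0 // divr_ge0 ?cabs_ge0 ?(ltW r0).
Qed.

Definition mx_close m n (A B : 'M[CC R]_(m, n)) (d : R) := forall i j, cabs (A i j - B i j) <= d.

(* When the end points coincide, the constant disk does the job. *)
Lemma lempert_near_diag m n (D : set 'M[CC R]_(m, n)) a d' e : 0 < d' -> 0 < e ->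
  (forall X, mx_close X a d' -> D X) ->
  exists2 d, 0 < d & forall a' b', mx_close a' a d -> mx_close b' a d ->
    lempert D a' b' <= e.
Proof.
move=> d'0 e0 HD; pose al := Num.min (e / 2) 2^-1.
have al0 : 0 < al by rewrite lt_min invr_gt0 ltr0n andbT; lra.
have al_e : al <= e / 2 by rewrite ge_min lexx.
have al_1 : al <= 2^-1 by rewrite ge_min lexx orbT.
have cal : cabs (rc al) = al by rewrite cabs_rc gtr0_norm.
have k0 : 0 < 1 + 2 / al by rewrite addr_gt0 ?divr_gt0.
exists (d' / (1 + 2 / al)) => [|a' b' Ha' Hb']; first by rewrite divr_gt0.
have J : joined D a' b' (rc al / rc 1).
  apply: (@perturb_disk m n D (fun=> a) 1 (rc al) (d' / (1 + 2 / al)) d') => //.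
  - by rewrite ltr01 lexx.
  - by rewrite -cabs_gt0 cal.
  - by rewrite cal; lra.
  - by move=> w X _; exact: HD.
  - by rewrite divr_ge0 // ltW.
  - by rewrite cal divfK // gt_eqF.
by apply: le_trans (lempert_le J) _; rewrite rc1 invr1 mulr1 cal; lra.
Qed.

Lemma shrink_radius x e : 0 <= x -> 0 < e -> x + e < 1 ->
  exists r, [/\ 0 < r < 1, x < r & x / r <= x + e].
Proof.
move=> x0 e0 xe; exists (1 + e)^-1; have e1 : 0 < 1 + e by lra.
have xe0 := mulr_ge0 x0 (ltW e0); have xe1 : x * e <= e.
  by rewrite ler_piMl ?(ltW e0) //; lra.
split; first by rewrite invr_gt0 e1 invf_lt1 //; lra.
- by rewrite -[X in _ < X]mul1r ltr_pdivlMr //; lra.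
- by rewrite invrK; lra.
Qed.

End Lempert.

(** * Moving end points in the polydisk and in the ball *)

Section Semicontinuity.
Variable R : realType.
Implicit Types (z w t : CC R) (x y e r rho d : R).

Lemma mx_close_le m n (A B : 'M[CC R]_(m, n)) d d' : d <= d' -> mx_close A B d -> mx_close A B d'.
Proof. by move=> dd' AB i j; exact: le_trans (AB i j) dd'. Qed.

Lemma mx_close_refl m n (A : 'M[CC R]_(m, n)) d : 0 <= d -> mx_close A A d.
Proof. by move=> d0 i j; rewrite subrr cabs0. Qed.

Lemma mx_close_trans m n (A B C : 'M[CC R]_(m, n)) d d' :
  mx_close A B d -> mx_close B C d' -> mx_close A C (d + d').
Proof.
move=> AB BC i j; rewrite -(subrKA (B i j)).
by rewrite (le_trans (cabsD _ _)) // lerD.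
Qed.

Lemma mx_close_sym m n (A B : 'M[CC R]_(m, n)) d : mx_close A B d -> mx_close B A d.
Proof. by move=> AB i j; rewrite cabsB. Qed.

Lemma mx_close_rV n (a b : 'rV[CC R]_n) d :
  (forall j, cabs (a 0 j - b 0 j) <= d) <-> mx_close a b d.
Proof. by split=> [H i j|H j]; [rewrite (ord1 i)|]; exact: H. Qed.

Lemma holo_polydisk n (phi : CC R -> 'rV[CC R]_n) : (0 < n)%N ->
  holo_disk (symmetrized_polydisk R n) phi <-> holo_disk (@roots_lt1 R n) phi.
Proof.
by move=> n0; split=> H z /H[? ?]; split=> //; apply/symmetrized_polydiskP.
Qed.

(** Points that are apart cannot be joined with a small [alpha]. Each coordinate of the disk is
    bounded by [2 ^+ n], so [bounded_holo_dist] applies on the unit disk. *)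
Lemma joined_sep n (a b : 'rV[CC R]_n) alpha j : (0 < n)%N ->
  joined (symmetrized_polydisk R n) a b alpha -> cabs alpha <= 1 / 8 ->
  cabs (b 0 j - a 0 j) ^+ 2 <= 32 * (2 ^+ n) ^+ 2 * cabs alpha.
Proof.
move=> n0 [al1 [phi [/(holo_polydisk _ n0) Hphi <- <-]]] al8.
have H0 : 0 < 2 ^+ n :> R by rewrite exprn_gt0.
have := @bounded_holo_dist R (fun w => phi w 0 j) 0 1 alpha (2 ^+ n) ltr01 H0.
rewrite subr0 divr1; apply=> //.
move=> w; rewrite subr0 => w1; have [Hw dw] := Hphi w w1; split.
  by move/derivable_mxCP: dw; exact.
exact: roots_lt1_bounded.
Qed.

(** Stated for two pairs near [(a0, b0)], so that letting either of them be [(a0, b0)] yields upper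
    and lower semicontinuity together. A joining disk for [(a, b)] is assumed to exist because the
    infimum of the empty set is 0. *)
Lemma lempert_polydisk_near n (a0 b0 : 'rV[CC R]_n) e : (0 < n)%N ->
  symmetrized_polydisk R n a0 -> symmetrized_polydisk R n b0 -> 0 < e ->
  exists2 d, 0 < d & forall a b a' b', mx_close a a0 d -> mx_close b b0 d ->
    mx_close a' a0 d -> mx_close b' b0 d ->
    (exists alpha, joined (symmetrized_polydisk R n) a b alpha) ->
    lempert (symmetrized_polydisk R n) a' b' <= lempert (symmetrized_polydisk R n) a b + e.
Proof.
move=> n0 /(symmetrized_polydiskP _ n0)/roots_lt1_le[rho0 /andP[r00 r01] Ha0] Gb0 e0.
have [ab|ab] := eqVneq b0 a0.
  have [d1 d10 Hd1] := @roots_open R n _ _ (ltW r00) r01 (lexx 1).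
  have [|d d0 Hd] := @lempert_near_diag R 1 n (symmetrized_polydisk R n) a0 d1 e d10 e0.
    move=> X /mx_close_rV HX; apply/symmetrized_polydiskP => //.
    by move=> z; exact: (Hd1 a0 X Ha0 HX).
  exists d => // a b a' b' _ _ Ha' Hb' _.
  rewrite (le_trans (Hd a' b' Ha' _)) -?ab //.
  by rewrite lerDr; exact: lempert_ge0.
have [j abj] : exists j, b0 0 j - a0 0 j != 0.
  apply: contrapT => nj; move/eqP: ab; apply; apply/rowP => j.
  apply: contrapT => nabj; apply: nj; exists j; rewrite subr_eq0.
  exact/eqP.
pose eta := cabs (b0 0 j - a0 0 j); have eta0 : 0 < eta by rewrite cabs_gt0.
(* Roots at [a0] are at most [rho0], so those at any nearby [a] are below [rho1]; this starts
   [roots_contract] with one constant for all disks. *)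
pose rho1 := (1 + rho0) / 2.
have [d1 d10 Hd1] := @roots_open R n rho0 rho1 (ltW r00) ltac:(rewrite /rho1; lra) ltac:(rewrite /rho1; lra).
(* Shrinking by [r] turns [alpha] into [alpha / r], which costs at most [e / 2]. *)
pose r := (1 + e / 2)^-1.
have e21 : 1 < 1 + e / 2 by lra.
have rI : 0 < r < 1 by rewrite invr_gt0 invf_lt1 //; lra.
have rI' : 0 <= r < 1 by case/andP: rI => /ltW -> ->.
have rho11 : rho1 < 1 by rewrite /rho1; lra.
have [rho2 /andP[rho20 rho21] Hrho2] := roots_contract n0 rI' rho11.
have [d2 d20 Hd2] := @roots_open R n rho2 1 rho20 rho21 (lexx 1).
pose M := 32 * (2 ^+ n) ^+ 2 : R.
have M0 : 0 < M by rewrite mulr_gt0 // !exprn_gt0.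
(* The lower bound on [|alpha|] from [joined_sep]: after moving both end points by at most
   [eta / 4], the [j]-th coordinates still differ by [eta / 2]. *)
pose c0 := Num.min (1 / 8) ((eta / 2) ^+ 2 / M).
have c00 : 0 < c0 by rewrite lt_min !divr_gt0 // exprn_gt0 // divr_gt0.
(* The leading 2 is there because [a'] and [a] are each [d]-close to [a0], hence only [2 * d]-close
   to each other. *)
pose k := 2 * (1 + 2 / c0).
have k0 : 0 < k by rewrite mulr_gt0 // addr_gt0 // divr_gt0.
pose d := Num.min d1 (Num.min (eta / 4) (d2 / k)).
have d0 : 0 < d by rewrite !lt_min d10 !divr_gt0.
have dd1 : d <= d1 by rewrite ge_min lexx.
have deta : d <= eta / 4 by rewrite !ge_min lexx !orbT.
have dd2 : d * k <= d2 by rewrite -ler_pdivlMr // !ge_min lexx !orbT.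
exists d => // a b a' b' Ha Hb Ha' Hb' J.
set l := lempert _ a b; have l0 : 0 <= l by exact: lempert_ge0.
have [le1|le1] := leP 1 (l + e); first by apply: le_trans le1; exact: lempert_le1.
have [|alpha Jal al_l] := lempert_lt J (e := e / 2); first by lra.
have c0al : c0 <= cabs alpha.
  have [al8|/ltW al8] := leP (cabs alpha) (1 / 8); last first.
    by apply: le_trans al8; rewrite ge_min lexx.
  apply: (@le_trans _ _ ((eta / 2) ^+ 2 / M)); first by rewrite ge_min lexx orbT.
  rewrite ler_pdivrMr // [X in _ <= X]mulrC; apply: le_trans (joined_sep j n0 Jal al8).
  rewrite lerXn2r ?nnegrE ?cabs_ge0 ?divr_ge0 ?(ltW eta0) //.
  have Haj := Ha 0 j; have Hbj := Hb 0 j.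
  have := cabsD (b 0 j - a 0 j) (a 0 j - a0 0 j).
  have := cabsD (b 0 j - a 0 j + (a 0 j - a0 0 j)) (- (b 0 j - b0 0 j)).
  rewrite cabsN (_ : b 0 j - a 0 j + (a 0 j - a0 0 j) - (b 0 j - b0 0 j) = b0 0 j - a0 0 j).
    by rewrite -/eta; lra.
  by ring.
have al0 : alpha != 0 by rewrite -cabs_gt0 (lt_le_trans c00).
have [al1 [phi [Hphi phi0 phial]]] := Jal.
have alr : cabs alpha / r = cabs alpha * (1 + e / 2) by rewrite /r invrK.
have alre : cabs alpha / r < l + e.
  rewrite alr mulrDr mulr1; have : cabs alpha * (e / 2) <= e / 2.
    by rewrite ler_piMl //; [lra|exact: ltW].
  lra.
have J' : joined (symmetrized_polydisk R n) a' b' (alpha / rc r).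
  have [r0 r1] := andP rI.
  apply: (@perturb_disk R 1 n _ phi r alpha (2 * d) d2) => //.
  - by rewrite r0 ltW.
  - by rewrite -[X in _ < X]mul1r -ltr_pdivrMr //; lra.
  - by move=> w /Hphi[].
  - move=> w X wr /mx_close_rV HX; apply/symmetrized_polydiskP => // z.
    apply: (Hd2 (phi w) X _ HX).
    apply: (Hrho2 phi _ _ w wr); first by apply/holo_polydisk.
    rewrite phi0 => v vr; apply/ltW; apply: (Hd1 a0 a Ha0 _ v vr).
    by apply/mx_close_rV; exact: mx_close_le dd1 Ha.
  - rewrite phi0 mulr_natl mulr2n; apply: mx_close_trans Ha' _; exact: mx_close_sym.
  - rewrite phial mulr_natl mulr2n; apply: mx_close_trans Hb' _; exact: mx_close_sym.
  - by rewrite mulr_ge0 // ltW.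
  - apply: le_trans dd2.
    rewrite (_ : 2 * d * (1 + 2 / cabs alpha) = d * (2 * (1 + 2 / cabs alpha))); last by ring.
    by rewrite /k !ler_wpM2l ?(ltW d0) // lerD2l ler_wpM2l // lef_pV2 ?posrE // (lt_le_trans c00).
apply: le_trans (lempert_le J') _.
rewrite cabsM cabsV cabs_rc gtr0_norm; first exact: ltW.
by case/andP: rI.
Qed.

Lemma square_cover a (d : CC R) w : in_square a d w ->
  [\/ in_square a (d / 2) w, in_square (a + d / 2) (d / 2) w,
      in_square (a + ci R * (d / 2)) (d / 2) w |
      in_square (a + d / 2 + ci R * (d / 2)) (d / 2) w].
Proof.
move=> [x [y [xI yI ->]]].
have E b1 b2 x' y' : 0 <= x' <= 1 -> 0 <= y' <= 1 -> (b1 + x') / 2 = x -> (b2 + y') / 2 = y ->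
    in_square (a + (rc b1 + ci R * rc b2) * (d / 2)) (d / 2) (pt a d x y).
  by move=> ? ? <- <-; exists x', y'; rewrite pt_child.
have [x2|/ltW x2] := leP x 2^-1; have [y2|/ltW y2] := leP y 2^-1.
- have := E 0 0 (2 * x) (2 * y).
  rewrite (_ : a + (rc 0 + ci R * rc 0) * (d / 2) = a); last by rewrite rc0; ring.
  by move=> H; constructor 1; apply: H; lra.
- have := E 0 1 (2 * x) (2 * y - 1).
  rewrite (_ : a + (rc 0 + ci R * rc 1) * (d / 2) = a + ci R * (d / 2)); last first.
    by rewrite rc0 rc1; ring.
  by move=> H; constructor 3; apply: H; lra.
- have := E 1 0 (2 * x - 1) (2 * y).
  rewrite (_ : a + (rc 1 + ci R * rc 0) * (d / 2) = a + d / 2); last first.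
    by rewrite rc0 rc1; ring.
  by move=> H; constructor 2; apply: H; lra.
- have := E 1 1 (2 * x - 1) (2 * y - 1).
  rewrite (_ : a + (rc 1 + ci R * rc 1) * (d / 2) = a + d / 2 + ci R * (d / 2)); last first.
    by rewrite rc1; ring.
  by move=> H; constructor 4; apply: H; lra.
Qed.

(** Compactness of the closed disk of radius [r], by [square_induction] on the square of side
    [2 * r] around it. Here [d] depends on [phi]. *)
Lemma disk_margin m n (D : set 'M[CC R]_(m, n)) (phi : CC R -> 'M[CC R]_(m, n)) r :
  (forall A, D A -> exists2 d, 0 < d & forall X, mx_close X A d -> D X) ->
  holo_disk D phi -> 0 < r < 1 ->
  exists2 d, 0 < d & forall w X, cabs w <= r -> mx_close X (phi w) d -> D X.
Proof.
move=> Dop Hphi /andP[r0 r1].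
pose P a (q : CC R) := exists2 d, 0 < d & forall w X, in_square a q w -> cabs w <= r ->
  mx_close X (phi w) d -> D X.
have cont p (d : R) : cabs p < 1 -> 0 < d ->
    exists2 e, 0 < e & forall w, cabs (w - p) < e -> mx_close (phi w) (phi p) d.
  move=> p1 d0; have [_ /derivable1_diffP/differentiable_continuous cphi] := Hphi p p1.
  have /nbhs_CCP[e e0 He] : nbhs p [set w | mx_close (phi w) (phi p) d].
    apply: (cphi [set X | mx_close X (phi p) d]); apply/nbhs_mxP; exists d => // X HX i j.
    exact/ltW/HX.
  by exists e.
have [d d0 Hd] : P (- (rc r + ci R * rc r)) (rc (2 * r)).
  apply: square_induction => [a q [d1 d10 H1] [d2 d20 H2] [d3 d30 H3] [d4 d40 H4]|p _].
    exists (Num.min (Num.min d1 d2) (Num.min d3 d4)); first by rewrite !lt_min d10 d20 d30 d40.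
    move=> w X /square_cover[] ws wr HX.
    - by apply: H1 ws wr _; apply: mx_close_le HX; rewrite !ge_min lexx.
    - by apply: H2 ws wr _; apply: mx_close_le HX; rewrite !ge_min lexx ?orbT.
    - by apply: H3 ws wr _; apply: mx_close_le HX; rewrite !ge_min lexx ?orbT.
    - by apply: H4 ws wr _; apply: mx_close_le HX; rewrite !ge_min lexx ?orbT.
  (* Small squares around a point outside the closed disk miss it, so any margin works there. *)
  have [pr|pr] := leP (cabs p) r; last first.
    exists ((cabs p - r) / 2) => [|a q qlt pq _]; first by rewrite divr_gt0 // subr_gt0.
    exists 1 => // w X wq wr; have := in_square_dist wq pq; have := cabsD (p - w) w.
    by rewrite subrK; lra.
  have p1 : cabs p < 1 by lra.
  have [Dp _] := Hphi p p1; have [d d0 Hd] := Dop _ Dp.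
  have [|e e0 He] := cont p (d / 2) p1; first by lra.
  exists (e / 2) => [|a q qlt pq _]; first by lra.
  exists (d / 2) => [|w X wq wr HX]; first by lra.
  apply: Hd; have -> : d = d / 2 + d / 2 by lra.
  apply: mx_close_trans HX (He w _).
  by have := in_square_dist pq wq; lra.
exists d => // w X wr; apply: Hd => //.
have rew := cre_le_cabs w; have imw := cim_le_cabs w.
have := cre_le_cabs (- w); have := cim_le_cabs (- w); rewrite cabsN creN cimN => rew' imw'.
exists ((cre w + r) / (2 * r)), ((cim w + r) / (2 * r)).
have r2 : 0 < 2 * r by lra.
split.
- by rewrite divr_ge0 ?ler_pdivrMr //; lra.
- by rewrite divr_ge0 ?ler_pdivrMr //; lra.
- have E x : rc (x / (2 * r)) * rc (2 * r) = rc x by rewrite -rcM divfK // gt_eqF.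
  rewrite /pt mulrDl -mulrA !E; apply: ccP; rewrite !cE; ring.
Qed.

Lemma spectral_ball_open n (A : 'M[CC R]_n) : (0 < n)%N -> spectral_ball R n A ->
  exists2 d, 0 < d & forall X, mx_close X A d -> spectral_ball R n X.
Proof.
move=> n0 /(spectral_ballP _ n0)/roots_lt1_le[rho /andP[r0 r1] HA].
have [e e0 He] := @roots_open R n _ _ (ltW r0) r1 (lexx 1).
have [d d0 Hd] := continuous_sigma A e0.
exists (d / 2) => [|X HX]; first by lra.
apply/(spectral_ballP _ n0) => z; apply: (He (sigma A) (sigma X) HA) => j.
by apply: ltW; apply: Hd => i k; apply: le_lt_trans (HX i k) _; lra.
Qed.

(** A single nearly optimal disk for [(A, B)] is perturbed to all nearby pairs, so a margin for that
    disk alone suffices. *)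
Lemma lempert_ball_usc n (A B : 'M[CC R]_n) e : (0 < n)%N ->
  spectral_ball R n A ->
  (exists alpha, joined (spectral_ball R n) A B alpha) -> 0 < e ->
  exists2 d, 0 < d & forall A' B', mx_close A' A d -> mx_close B' B d ->
    lempert (spectral_ball R n) A' B' <= lempert (spectral_ball R n) A B + e.
Proof.
move=> n0 HA J e0; have op X := @spectral_ball_open n X n0.
have [AB|AB] := eqVneq A B.
  have [d1 d10 Hd1] := op A HA.
  have [d d0 Hd] := lempert_near_diag d10 e0 Hd1.
  exists d => // A' B' HA' HB'; rewrite (le_trans (Hd A' B' HA' _)) ?AB //.
  by rewrite lerDr; exact: lempert_ge0.
set l := lempert _ A B; have l0 : 0 <= l by exact: lempert_ge0.
have [le1|le1] := leP 1 (l + e).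
  by exists 1 => // A' B' _ _; apply: le_trans le1; exact: lempert_le1.
have [|alpha [al1 [phi [Hphi phi0 phial]]] al_l] := lempert_lt J (e := e / 2); first by lra.
have al0 : alpha != 0 by apply: contraNN AB => /eqP E; rewrite -phi0 -phial E.
have [|||r [rI alr alre]] := @shrink_radius R (cabs alpha) (e / 2).
- exact: cabs_ge0.
- by lra.
- by rewrite -/l in al_l; lra.
have [d' d'0 Hd'] := disk_margin op Hphi rI.
have [r0 r1] := andP rI.
have k0 : 0 < 1 + 2 / cabs alpha by rewrite addr_gt0 // divr_gt0 // cabs_gt0.
exists (d' / (1 + 2 / cabs alpha)) => [|A' B' HA' HB']; first by rewrite divr_gt0.
have J' : joined (spectral_ball R n) A' B' (alpha / rc r).
  apply: (@perturb_disk R n n _ phi r alpha (d' / (1 + 2 / cabs alpha)) d') => //.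
  - by rewrite r0 ltW.
  - by move=> w /Hphi[].
  - by rewrite phi0.
  - by rewrite phial.
  - by rewrite divr_ge0 // ltW.
  - by rewrite divfK // gt_eqF.
apply: le_trans (lempert_le J') _.
by rewrite cabsM cabsV cabs_rc gtr0_norm // -/l in al_l *; lra.
Qed.

End Semicontinuity.

(** * Disks in the spectral ball *)
Section Paths.
Variable R : realType.
Implicit Types (z w t : CC R) (x y e r rho d : R).

Lemma char_poly_conj n (S X : 'M[CC R]_n) : S \in unitmx ->
  char_poly (S *m X *m invmx S) = char_poly X.
Proof.
move=> uS; rewrite /char_poly /char_poly_mx.
have E : 'X%:M - map_mx polyC (S *m X *m invmx S) =
    map_mx polyC S *m ('X%:M - map_mx polyC X) *m map_mx polyC (invmx S).
  rewrite mulmxBr mulmxBl !map_mxM; congr (_ - _).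
  by rewrite scalar_mxC -mulmxA -map_mxM mulmxV // map_mx1 mulmx1.
rewrite E !det_mulmx mulrAC -det_mulmx -map_mxM mulmxV //.
by rewrite map_mx1 det1 mul1r.
Qed.

Lemma sigma_conj n (S X : 'M[CC R]_n) : S \in unitmx ->
  sigma (S *m X *m invmx S) = sigma X.
Proof. by move=> uS; apply: sigma_inj_char_poly; rewrite char_poly_conj // spoly_sigma. Qed.

Lemma schur_triang n (A : 'M[CC R]_n) : (0 < n)%N ->
  exists S T, [/\ S \in unitmx, is_trig_mx T & A = S *m T *m invmx S].
Proof.
move=> n0; have [P /unitarymx_unit uP] := @Schur R[i] n A n0.
rewrite /similar_to /= conjumx // => trigT.
exists (invmx P), (P *m A *m invmx P); split => //; first by rewrite unitmx_inv.
by rewrite invmxK !mulmxA mulVmx // mul1mx -mulmxA mulVmx // mulmx1.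
Qed.

(* Repeated square roots with nonnegative real part tend to [1]. *)
Lemma root_near1 t e : t != 0 -> 0 < e ->
  exists k tau, tau ^+ (2 ^ k) = t /\ cabs (tau - 1) < e.
Proof.
move=> t0 e0; pose m := Num.min 1 (cabs t).
have m0 : 0 < m by rewrite lt_min ltr01 cabs_gt0.
have m1 : m <= 1 by rewrite ge_min lexx.
have mt : m <= cabs t by rewrite ge_min lexx orbT.
(* If [s ^ 2 = tau], [Re s >= 0] and [|tau| >= m], then [|s + 1| ^ 2 >= 1 + m >= (1 + h) ^ 2]. Since
   [tau - 1 = (s - 1) * (s + 1)], each square root divides the distance to 1 by at least [1 + h]. *)
pose h := m / 3; have h0 : 0 < h by rewrite divr_gt0.
have step k : exists tau, [/\ tau ^+ (2 ^ k) = t, m <= cabs tau &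
    cabs (tau - 1) * (1 + k%:R * h) <= cabs (t - 1)].
  elim: k => [|k [tau [tauk mtau Htau]]].
    by exists t; rewrite expn0 expr1 mul0r addr0 mulr1.
  pose s : CC R := sqrtc (tau : R[i]).
  have s2 : s ^+ 2 = tau by exact: (sqr_sqrtc (tau : R[i])).
  have res : 0 <= cre s by rewrite /s; case: (tau) => a b /=; exact: sqrtr_ge0.
  have cs2 : cabs s ^+ 2 = cabs tau by rewrite -cabsX s2.
  have ms : m <= cabs s.
    rewrite leNgt; apply/negP => sm; have s0 := cabs_ge0 s.
    have s1 : cabs s <= 1 by lra.
    by have := ler_wpM2l s0 s1; rewrite -expr2 cs2; lra.
  have s1 : 1 + h <= cabs (s + 1).
    rewrite -ler_sqr ?nnegrE ?cabs_ge0 //; last by rewrite addr_ge0 // ltW.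
    rewrite sqr_cabs -rc1 !cE; move: cs2; rewrite sqr_cabs /h; nra.
  exists s; split => //; first by rewrite expnS exprM s2.
  have s1_ge0 := cabs_ge0 (s - 1).
  have prodE : cabs (s - 1) * cabs (s + 1) = cabs (tau - 1).
    by rewrite -cabsM -s2; congr cabs; ring.
  apply: le_trans Htau; rewrite -prodE -mulrA ler_wpM2l //.
  have k0 : 0 <= k%:R * h by rewrite mulr_ge0 // ?ler0n // ltW.
  by rewrite -natr1; nra.
have [k Hk] : exists k : nat, cabs (t - 1) / (e * h) < k%:R.
  exists (Num.bound (cabs (t - 1) / (e * h))); apply: archi_boundP.
  by rewrite divr_ge0 ?cabs_ge0 // mulr_ge0 ?ltW.
have [tau [tauk _ Htau]] := step k; exists k, tau; split => //.
move: Hk; rewrite ltr_pdivrMr ?mulr_gt0 // => Hk.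
rewrite ltNge; apply/negP => He.
have kh0 : 0 <= k%:R * h by rewrite mulr_ge0 // ?ler0n // ltW.
have := ler_wpM2r kh0 He; lra.
Qed.

(** A substitute for [w |-> exp (w * log t)]: a high power of an affine function whose only possible
    zero is pushed out of the disk of radius [r] because [tau] is close to 1. *)
Lemma nonvanishing_interp t r : t != 0 -> 0 <= r ->
  exists f : CC R -> CC R, [/\ forall z, derivable f z 1, f 0 = 1, f 1 = t &
    forall w, cabs w <= r -> f w != 0].
Proof.
move=> t0 r0; have [|k [tau [tauk Htau]]] := @root_near1 t (r + 1)^-1 t0.
  by rewrite invr_gt0 ltr_wpDl.
exists (fun w => (1 + w * (tau - 1)) ^+ (2 ^ k)); split.
- move=> z; have subD := fun_subring_derivable z; have [Pc PD PM] := subD.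
  apply: (@fun_subringX _ _ _ subD (fun w => 1 + w * (tau - 1))).
  apply: (PD (fun=> 1) (fun w => w * (tau - 1)) (Pc 1)).
  exact: (PM id (fun=> tau - 1) (@derivable_id _ (CC R) z 1) (Pc _)).
- by rewrite mul0r addr0 expr1n.
- by rewrite mul1r addrC subrK.
- move=> w wr; rewrite expf_neq0 //; apply/eqP => E.
  have : cabs (w * (tau - 1)) = 1.
    by rewrite -cabsN -[RHS]cabs1; congr cabs; apply/eqP; rewrite -subr_eq0 -opprD oppr_eq0 addrC E.
  rewrite cabsM => E1.
  have := ler_wpM2r (cabs_ge0 (tau - 1)) wr; rewrite E1.
  have r1 : 0 < r + 1 by lra.
  move: Htau; rewrite -[X in _ < X]mul1r ltr_pdivlMr // => Htau.
  by have := cabs_ge0 (tau - 1); lra.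
Qed.

(** A straight segment from [P] to [Q] may meet singular matrices. After triangularising [P^-1 Q],
    invertibility concerns the diagonal only: its entries are interpolated without zeros, the others
    linearly. The parameter is [w / alpha], whence the radius [1 / |alpha|]. *)
Lemma unit_path n (P Q : 'M[CC R]_n) alpha : (0 < n)%N ->
  P \in unitmx -> Q \in unitmx -> alpha != 0 ->
  exists S : CC R -> 'M[CC R]_n, [/\ forall z i j, derivable (fun w => S w i j) z 1,
    S 0 = P, S alpha = Q & forall w, unit_disk w -> S w \in unitmx].
Proof.
move=> n0 uP uQ al0.
have [V [T [uV trigT VT]]] := schur_triang (invmx P *m Q) n0.
have T0 i : T i i != 0.
  have : \det (invmx P *m Q) != 0.
    by rewrite -unitfE -unitmxE unitmx_mul unitmx_inv uP.
  rewrite VT !det_mulmx (det_trig trigT) (bigD1 i) //=; apply: contraNneq => ->.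
  by rewrite mul0r mulr0 mul0r.
have ral : 0 <= (cabs alpha)^-1 by rewrite invr_ge0 cabs_ge0.
have [f Hf] := choice (fun i => nonvanishing_interp (T0 i) ral).
pose TT w : 'M[CC R]_n := \matrix_(i, j) if i == j then f i w else w * T i j.
have TTtrig w : is_trig_mx (TT w).
  apply/is_trig_mxP => i j ij; rewrite mxE -val_eqE /= ltn_eqF //.
  by move/is_trig_mxP: trigT => ->; rewrite // mulr0.
exists (fun w => P *m V *m TT (w / alpha) *m invmx V); split.
- move=> z i j; have subD := fun_subring_derivable z; have [Pc PD PM] := subD.
  apply: (fun_subring_mulmx subD) => [{}i {}j|a b]; last exact: Pc.
  apply: (fun_subring_mulmx subD) => [a b|{}i {}j]; first exact: Pc.
  have dal : derivable (fun w => w * alpha^-1) z 1.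
    exact: (PM id (fun=> alpha^-1) (@derivable_id _ (CC R) z 1) (Pc _)).
  have [ij|ij] := eqVneq i j.
    rewrite (_ : (fun w => _) = fun w => f i (w * alpha^-1)); last first.
      by apply/funext => w; rewrite mxE ij eqxx.
    have [df _ _ _] := Hf i; apply/derivable1_diffP.
    move/derivable1_diffP : dal => dal; have /derivable1_diffP df' := df (z * alpha^-1).
    exact: (differentiable_comp dal df').
  rewrite (_ : (fun w => _) = fun w => w * alpha^-1 * T i j); last first.
    by apply/funext => w; rewrite mxE (negPf ij).
  exact: (PM _ _ dal (Pc _)).
- rewrite mul0r (_ : TT 0 = 1%:M) ?mulmx1 ?mulmxK //.
  by apply/matrixP => i j; rewrite !mxE; case: eqVneq => _; [have [_ -> _ _] := Hf i|rewrite mul0r].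
- rewrite divff // (_ : TT 1 = T).
    by rewrite -!mulmxA [X in P *m X]mulmxA -VT mulmxA mulmxV // mul1mx.
  apply/matrixP => i j; rewrite !mxE; case: eqVneq => [<-|_]; last by rewrite mul1r.
  by have [_ _ -> _] := Hf i.
- move=> w w1; rewrite !unitmx_mul uP uV unitmx_inv uV andbT /= unitmxE unitfE (det_trig (TTtrig _)).
  apply/prodf_neq0 => i _; rewrite mxE eqxx; have [_ _ _] := Hf i; apply.
  by rewrite cabsM cabsV ler_piMl // ltW.
Qed.

Lemma conj_joined n (P Q : 'M[CC R]_n) (X : CC R -> 'M[CC R]_n) alpha : (0 < n)%N ->
  P \in unitmx -> Q \in unitmx -> alpha != 0 -> unit_disk alpha ->
  holo_disk (spectral_ball R n) X ->
  joined (spectral_ball R n) (P *m X 0 *m invmx P) (Q *m X alpha *m invmx Q) alpha.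
Proof.
move=> n0 uP uQ al0 al1 HX; have [S [dS S0 Sal uS]] := unit_path n0 uP uQ al0.
(* Written with the adjugate, the inverse is visibly a quotient of polynomials in the entries of
   [S w], hence derivable. *)
split => //; exists (fun w => S w *m X w *m ((\det (S w))^-1 *: \adj (S w))).
have invE w : unit_disk w -> (\det (S w))^-1 *: \adj (S w) = invmx (S w).
  by move=> w1; rewrite /invmx uS.
have disk0 : unit_disk (0 : CC R) by change (cabs (0 : CC R) < 1); rewrite cabs0.
split; last 2 first.
- by rewrite (invE _ disk0) S0.
- by rewrite (invE _ al1) Sal.
move=> w w1; have [Xw dX] := HX w w1; split.
  rewrite (invE _ w1); apply/(spectral_ballP _ n0); rewrite (sigma_conj _ (uS w w1)).
  exact/(spectral_ballP _ n0).
have subD := fun_subring_derivable w; have [Pc PD PM] := subD.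
apply/derivable_mxCP; apply: (fun_subring_mulmx subD) => i j.
  apply: (fun_subring_mulmx subD) => // {}i {}j.
  by move/derivable_mxCP: dX; exact.
rewrite (_ : (fun v => _) = fun v => (\det (S v))^-1 * (\adj (S v)) i j); last first.
  by apply/funext => v; rewrite mxE.
apply: PM; last exact: (fun_subring_adj subD).
apply: derivableV; last exact: (fun_subring_det subD).
by rewrite -unitfE -unitmxE uS.
Qed.

End Paths.

(** * Existence of joining disks, and cyclic matrices *)

Section Disks.
Variable R : realType.
Implicit Types (z w t : CC R) (x y e r rho d : R).

Lemma derivable_mobius (a b c e : CC R) z : 1 + c * z != 0 ->
  derivable (fun w => (a + b * w) / (1 + c * w)) z 1.
Proof.
move=> den0; have [Pc PD PM] := fun_subring_derivable z.
have aff (u v : CC R) : derivable (fun w => u + v * w) z 1.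
  exact: (PD _ _ (Pc u) (PM _ _ (Pc v) (@derivable_id _ (CC R) z 1))).
have dV : derivable (fun w => (1 + c * w)^-1) z 1.
  by apply: derivableV; [exact: den0|exact: aff].
exact: (derivableM (aff a b) dV).
Qed.

Lemma cabs_mobius_lt (l u : CC R) : cabs l < 1 -> cabs u < 1 ->
  1 + cconj l * u != 0 /\ cabs ((l + u) / (1 + cconj l * u)) < 1.
Proof.
move=> l1 u1; have den0 : 1 + cconj l * u != 0.
  apply/eqP => E; have : cabs (cconj l * u) = 1.
    by rewrite -cabsN -[RHS]cabs1; congr cabs; apply/eqP; rewrite -subr_eq0 -opprD oppr_eq0 addrC E.
  rewrite cabsM cabs_conj => E1.
  by have := ler_wpM2r (cabs_ge0 u) (ltW l1); lra.
split=> //; rewrite cabsM cabsV ltr_pdivrMr ?cabs_gt0 // mul1r.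
rewrite -ltr_sqr ?nnegrE ?cabs_ge0 // -subr_gt0.
have -> : cabs (1 + cconj l * u) ^+ 2 - cabs (l + u) ^+ 2 = (1 - cabs l ^+ 2) * (1 - cabs u ^+ 2).
  by rewrite !sqr_cabs -rc1 !cE cre_conj cim_conj; ring.
by rewrite mulr_gt0 // subr_gt0 expr_lt1 ?cabs_ge0.
Qed.

(** Here [|m|] is the pseudohyperbolic distance of [l] and [u], and [f] is a scaling by [m / alpha]
    followed by the automorphism sending 0 to [l]. Allowing every larger [|alpha|] lets several
    pairs share one node. *)
Lemma disk_interp (l u : CC R) : cabs l < 1 -> cabs u < 1 ->
  exists2 m : CC R, cabs m < 1 & forall alpha, cabs m < cabs alpha ->
    exists f : CC R -> CC R, [/\ f 0 = l, f alpha = u &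
      forall w, unit_disk w -> derivable f w 1 /\ cabs (f w) < 1].
Proof.
move=> l1 u1; exists ((- l + u) / (1 + cconj (- l) * u)).
  by have [] := @cabs_mobius_lt (- l) u _ u1; rewrite ?cabsN.
have [den0 _] := @cabs_mobius_lt (- l) u ltac:(by rewrite cabsN) u1.
set m := _ / _ => alpha m_al.
have al0 : alpha != 0 by rewrite -cabs_gt0 (le_lt_trans _ m_al) ?cabs_ge0.
have conjN : cconj (- l) = - cconj l by case: (l).
have ll : 1 - cconj l * l != 0.
  rewrite -cabs_gt0; have := cabsD (1 - cconj l * l) (cconj l * l).
  rewrite subrK cabs1 cabsM cabs_conj => ?.
  by have := ler_wpM2r (cabs_ge0 l) (ltW l1); lra.
pose f w := (l + (m / alpha) * w) / (1 + (cconj l * (m / alpha)) * w).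
exists f; split.
- by rewrite /f !mulr0 !addr0 invr1 mulr1.
- have mE : m / alpha * alpha = m by rewrite divfK.
  rewrite /f -(mulrA (cconj l)) mE /m conjN; rewrite conjN in den0.
  have E : 1 + cconj l * ((- l + u) / (1 + - cconj l * u)) =
    (1 - cconj l * l) / (1 + - cconj l * u) by field.
  have E' : l + (- l + u) / (1 + - cconj l * u) =
     u * (1 - cconj l * l) / (1 + - cconj l * u) by field.
  by rewrite E E'; field; rewrite den0 ll.
- move=> w w1; have u'1 : cabs (m / alpha * w) < 1.
    rewrite (cabsM (m / alpha)) (cabsM m) cabsV; have w_1 : cabs w < 1 by [].
    have H : cabs m / cabs alpha < 1.
      by rewrite ltr_pdivrMr ?mul1r // cabs_gt0.
    have H0 : 0 <= cabs m / cabs alpha by rewrite divr_ge0 ?cabs_ge0.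
    by apply: le_lt_trans H; have := ler_wpM2l H0 (ltW w_1); rewrite mulr1.
  have [den lt1] := cabs_mobius_lt l1 u'1; rewrite mulrA in den lt1.
  split; last exact: lt1.
  exact: derivable_mobius.
Qed.

Lemma roots_lt1_trig n (T : 'M[CC R]_n) : is_trig_mx T ->
  roots_lt1 (sigma T) <-> forall i, cabs (T i i) < 1.
Proof.
move=> trigT; rewrite /roots_lt1 spoly_sigma char_poly_trig //; split=> [H i|H z].
  apply: H; rewrite /root horner_prod (bigD1 i) //= !hornerE subrr mul0r.
  exact: eqxx.
rewrite /root horner_prod => /prodf_eq0[i _]; rewrite !hornerE subr_eq0 => /eqP ->.
exact: H.
Qed.

Lemma finite_family_bound n (m : 'I_n -> CC R) : (forall i, cabs (m i) < 1) ->
  exists2 rho, 0 < rho < 1 & forall i, cabs (m i) <= rho.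
Proof.
move=> Hm; have [z /mapP[i _ ->] //|rho rhoI Hrho] := @finite_bound R [seq m i | i <- enum 'I_n].
by exists rho => // i; apply: Hrho; rewrite map_f // mem_enum.
Qed.

(** Ensures that the infimum in [lempert] is over a nonempty set. Both matrices are triangularised,
    the diagonals are joined inside the unit disk with a common [alpha], the other entries linearly,
    and [conj_joined] restores the two bases. *)
Lemma ball_joined n (A B : 'M[CC R]_n) : (0 < n)%N ->
  spectral_ball R n A -> spectral_ball R n B ->
  exists alpha, joined (spectral_ball R n) A B alpha.
Proof.
move=> n0 /(spectral_ballP _ n0) HA /(spectral_ballP _ n0) HB.
have [P [T [uP trigT AE]]] := schur_triang A n0.
have [Q [U [uQ trigU BE]]] := schur_triang B n0.
have T1 : forall i, cabs (T i i) < 1.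
  by apply/(roots_lt1_trig trigT); rewrite -(sigma_conj T uP) -AE.
have U1 : forall i, cabs (U i i) < 1.
  by apply/(roots_lt1_trig trigU); rewrite -(sigma_conj U uQ) -BE.
have HTU i : exists m : CC R, cabs m < 1 /\ forall alpha, cabs m < cabs alpha ->
    exists f : CC R -> CC R, [/\ f 0 = T i i, f alpha = U i i &
      forall w, unit_disk w -> derivable f w 1 /\ cabs (f w) < 1].
  by have [m m1 Hm] := disk_interp (T1 i) (U1 i); exists m.
have [m Hm] := choice HTU.
have [rho /andP[rho0 rho1] Hrho] := finite_family_bound (fun i => proj1 (Hm i)).
pose alpha : CC R := rc ((1 + rho) / 2).
have cal : cabs alpha = (1 + rho) / 2 by rewrite cabs_rc ger0_norm //; lra.
have al0 : alpha != 0 by rewrite -cabs_gt0 cal; lra.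
have al1 : unit_disk alpha by change (cabs alpha < 1); lra.
have Hm' i : cabs (m i) < cabs alpha by rewrite cal; have := Hrho i; lra.
have [f Hf] := choice (fun i => proj2 (Hm i) alpha (Hm' i)).
pose X w : 'M[CC R]_n :=
  \matrix_(i, j) if i == j then f i w else T i j + w * ((U i j - T i j) / alpha).
have trigX w : is_trig_mx (X w).
  apply/is_trig_mxP => i j ij; rewrite mxE -val_eqE /= ltn_eqF //.
  move/is_trig_mxP: (trigT) => -> //; move/is_trig_mxP: (trigU) => -> //.
  by rewrite subr0 mul0r mulr0 addr0.
exists alpha; rewrite AE BE.
have <- : X 0 = T.
  apply/matrixP => i j; rewrite mxE; case: eqVneq => [<-|_]; last by rewrite mul0r addr0.
  by have [] := Hf i.
have <- : X alpha = U.
  apply/matrixP => i j; rewrite mxE; case: eqVneq => [<-|_]; first by have [] := Hf i.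
  by rewrite mulrCA divff // mulr1 addrC subrK.
apply: conj_joined => // w w1; split.
  apply/(spectral_ballP _ n0)/(roots_lt1_trig (trigX w)) => i.
  by rewrite mxE eqxx; have [_ _ /(_ w w1)[]] := Hf i.
apply/derivable_mxCP => i j.
have [ij|ij] := eqVneq i j.
  rewrite (_ : (fun v => _) = f i); last by apply/funext => v; rewrite mxE ij eqxx.
  by have [_ _ /(_ w w1)[]] := Hf i.
have [Pc PD PM] := fun_subring_derivable w.
rewrite (_ : (fun v => _) = fun v => T i j + v * ((U i j - T i j) / alpha)); last first.
  by apply/funext => v; rewrite mxE (negPf ij).
exact: (PD _ _ (Pc _) (PM _ _ (@derivable_id _ (CC R) w 1) (Pc _))).
Qed.

(** The Krylov matrix [K] of a cyclic vector intertwines [A^T] with the companion matrix: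
    multiplication by [A^T] moves each row to the next, and Cayley-Hamilton expresses the image of
    the last one. *)
Lemma cyclic_companion n (A : 'M[CC R]_n) : (0 < n)%N -> cyclic_mx A ->
  exists2 P, P \in unitmx & A = P *m (companion (sigma A))^T *m invmx P.
Proof.
case: n A => // n A _ [v]; set K := (X in row_full X); rewrite row_full_unit => uK.
have KA : K *m A^T = companion (sigma A) *m K.
  apply/row_matrixP => j; rewrite !row_mul rowK.
  have -> : (A ^+ j *m v)^T *m A^T = (A ^+ j.+1 *m v)^T.
    by rewrite -trmx_mul mulmxA exprS.
  rewrite mulmx_sum_row.
  have [jn|jn] := eqVneq (j : nat) n; last first.
    have jn' : (j.+1 < n.+1)%N by rewrite ltn_neqAle eqSS jn (ltn_ord j).
    rewrite (bigD1 (Ordinal jn')) //= big1 ?addr0 => [|k kj].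
      by rewrite rowK mxE companionE (negPf jn) eqxx scale1r.
    rewrite mxE companionE (negPf jn) (_ : (j.+1 == k) = false) ?scale0r //.
    by apply: contraNF kj => /eqP E; apply/eqP/val_inj.
  have CH := Cayley_Hamilton A; have sz := size_char_poly A.
  have pn : (char_poly A)`_n.+1 = 1.
    by have := monicP (char_poly_monic A); rewrite lead_coefE sz.
  have {}CH : A ^+ n.+1 = - \sum_(k < n.+1) (char_poly A)`_k *: A ^+ k.
    move: CH; rewrite -{1}[char_poly A]coefK poly_def sz raddf_sum big_ord_recr /= => /eqP.
    rewrite addrC addr_eq0 => /eqP.
    rewrite linearZ rmorphXn /= horner_mx_X pn scale1r => ->.
    by congr (- _); apply: eq_bigr => k _; rewrite linearZ rmorphXn /= horner_mx_X.
  rewrite jn CH mulNmx mulmx_suml linearN linear_sum /= -sumrN.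
  apply: eq_bigr => k _; rewrite rowK mxE companionE jn eqxx spoly_sigma.
  by rewrite -scalemxAl linearZ /= scaleNr.
exists K^T; first by rewrite unitmx_tr.
rewrite -trmx_inv -!trmx_mul -(mulmxK uK (companion _)) -KA.
by rewrite mulmxKV // mulKmx // trmxK.
Qed.

End Disks.

(** * Comparison of the two Lempert functions, and density of cyclic matrices *)

Section Lifting.
Variable R : realType.
Implicit Types (z w t : CC R) (x y e r rho d : R).

Lemma sigma_trmx n (A : 'M[CC R]_n) : sigma A^T = sigma A.
Proof.
apply: sigma_inj_char_poly; rewrite spoly_sigma /char_poly -det_tr; congr (\det _).
by rewrite /char_poly_mx linearB /= tr_scalar_mx map_trmx trmxK.
Qed.

Lemma lift_joined n (A B : 'M[CC R]_n) alpha : (0 < n)%N -> cyclic_mx A -> cyclic_mx B ->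
  alpha != 0 -> joined (symmetrized_polydisk R n) (sigma A) (sigma B) alpha ->
  joined (spectral_ball R n) A B alpha.
Proof.
move=> n0 /(cyclic_companion n0)[P uP AE] /(cyclic_companion n0)[Q uQ BE] al0.
move=> [al1 [phi [/(holo_polydisk _ n0) Hphi phi0 phial]]].
rewrite AE BE -phi0 -phial.
apply: (@conj_joined R n P Q (fun w => (companion (phi w))^T) alpha n0 uP uQ al0 al1).
move=> w w1; have [Hw dw] := Hphi w w1; split.
  by apply/(spectral_ballP _ n0); rewrite sigma_trmx sigma_companion.
move/derivable_mxCP: dw => dw; have subD := fun_subring_derivable w.
have [Pc _ _] := subD; apply/derivable_mxCP => i j.
have [jn|jn] := eqVneq (j : nat) n.-1.
  rewrite (_ : (fun v => _) = fun v => - (spoly (phi v))`_i); last first.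
    by apply/funext => v; rewrite mxE companionE jn eqxx.
  apply: (fun_subringN subD); exact: (fun_subring_coef_spoly i subD (dw 0)).
rewrite (_ : (fun v => _) = fun=> (j.+1 == i :> nat)%:R); first exact: Pc.
by apply/funext => v; rewrite mxE companionE (negPf jn).
Qed.

Lemma joined_sigma n (A B : 'M[CC R]_n) alpha : joined (spectral_ball R n) A B alpha ->
  joined (symmetrized_polydisk R n) (sigma A) (sigma B) alpha.
Proof.
move=> [al1 [phi [Hphi <- <-]]]; split; first exact: al1.
exists (fun w => sigma (phi w)); split; [|exact: erefl|exact: erefl].
move=> w /Hphi[Hw dw]; split; first by exists (phi w).
exact: derivable_sigma.
Qed.

Lemma polydisk_joined n (A B : 'M[CC R]_n) : (0 < n)%N ->
  spectral_ball R n A -> spectral_ball R n B ->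
  exists alpha, joined (symmetrized_polydisk R n) (sigma A) (sigma B) alpha.
Proof.
move=> n0 HA HB; have [alpha J] := ball_joined n0 HA HB.
by exists alpha; exact: joined_sigma.
Qed.

Lemma lempert_sigma_le n (A B : 'M[CC R]_n) : (0 < n)%N ->
  spectral_ball R n A -> spectral_ball R n B ->
  lempert (symmetrized_polydisk R n) (sigma A) (sigma B) <= lempert (spectral_ball R n) A B.
Proof.
move=> n0 HA HB; apply: lb_le_inf.
  by have [alpha J] := ball_joined n0 HA HB; exists (cabs alpha), alpha.
by move=> _ [alpha J <-]; exact: lempert_le (joined_sigma J).
Qed.

Lemma lempert_cyclic n (A B : 'M[CC R]_n) : (0 < n)%N ->
  spectral_ball R n A -> spectral_ball R n B -> cyclic_mx A -> cyclic_mx B ->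
  lempert (spectral_ball R n) A B =
  lempert (symmetrized_polydisk R n) (sigma A) (sigma B).
Proof.
move=> n0 HA HB cA cB; apply/eqP; rewrite eq_le lempert_sigma_le // andbT.
apply/ler_addgt0Pr => e e0.
have [|alpha J al_l] := lempert_lt (polydisk_joined n0 HA HB) (e := e); first exact: e0.
have [al0|al0] := eqVneq alpha 0; last first.
  by apply: le_trans (lempert_le (lift_joined n0 cA cB al0 J)) (ltW al_l).
(* A disk with [alpha = 0] says only that [sigma A = sigma B] and cannot be lifted when [A] and [B]
   differ. The constant disk with a small nonzero node [beta] replaces it. *)
have [_ [phi [Hphi phi0 phial]]] := J.
have sAB : sigma B = sigma A by rewrite -phi0 -phial al0.
pose beta : CC R := rc (Num.min e 2^-1).
have b0 : 0 < Num.min e 2^-1 by rewrite lt_min e0 invr_gt0 ltr0n.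
have cb : cabs beta = Num.min e 2^-1 by rewrite cabs_rc gtr0_norm.
have Jb : joined (symmetrized_polydisk R n) (sigma A) (sigma B) beta.
  split.
    change (cabs beta < 1); rewrite cb.
    by have : Num.min e 2^-1 <= 2^-1; [rewrite ge_min lexx orbT|lra].
  exists (fun=> sigma A); split; [|exact: erefl|exact: esym sAB].
  move=> w _; split; [exact: (ex_intro2 _ _ A HA erefl)|exact: derivable_cst].
have bn0 : beta != 0 by rewrite -cabs_gt0 cb.
apply: le_trans (lempert_le (lift_joined n0 cA cB bn0 Jb)) _.
rewrite cb ge_min; apply/orP; left; rewrite lerDr; exact: lempert_ge0.
Qed.

Lemma small_nonroot (p : {poly CC R}) e : p != 0 -> 0 < e ->
  exists s : CC R, cabs s < e /\ ~~ root p s.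
Proof.
move=> p0 e0; have [rs pE] := @closed_field_poly_normal R[i] p.
have [eta eta0 Heta] : exists2 eta : R, 0 < eta & forall z : CC R, z \in rs -> z != 0 -> eta <= cabs z.
  elim: (rs : seq (CC R)) => [|z s [eta eta0 Heta]]; first by exists 1.
  have [->|z0] := eqVneq z 0.
    by exists eta => // w; rewrite inE => /orP[/eqP ->|/Heta //]; rewrite eqxx.
  exists (Num.min eta (cabs z)) => [|w]; first by rewrite lt_min eta0 cabs_gt0.
  rewrite inE ge_min => /orP[/eqP ->|ws w0]; first by rewrite lexx orbT.
  by rewrite Heta.
have m0 : 0 < Num.min e eta by rewrite lt_min e0.
pose s : CC R := rc (Num.min e eta / 2).
have cs : cabs s = Num.min e eta / 2 by rewrite cabs_rc ger0_norm // divr_ge0 // ltW.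
have me : Num.min e eta <= e by rewrite ge_min lexx.
have meta : Num.min e eta <= eta by rewrite ge_min lexx orbT.
exists s; split; first by lra.
have lp : lead_coef p != 0 by rewrite lead_coef_eq0.
rewrite pE rootZ // root_prod_XsubC; apply/negP => srs.
have s0 : s != 0 by rewrite -cabs_gt0 cs divr_gt0.
by have := Heta s srs s0; lra.
Qed.

Definition krylov n (A : 'M[CC R]_n) (v : 'cV[CC R]_n) : 'M[CC R]_n :=
  \matrix_(j < n) (A ^+ j *m v)^T.

(** The nilpotent shift runs through the standard basis, so its Krylov matrix at the first basis
    vector is the identity. It is the cyclic end of the line used in [cyclic_dense]. *)
Lemma krylov_shift n : exists (C : 'M[CC R]_n.+1) v, \det (krylov C v) = 1.
Proof.
pose C : 'M[CC R]_n.+1 := \matrix_(i, j) (j.+1 == i)%:R.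
exists C, (delta_mx 0 0); have HC j : (j < n.+1)%N ->
    C ^+ j *m (delta_mx 0 0 : 'cV_n.+1) = \col_i (i == j :> nat)%:R.
  elim: j => [_|j IH jn].
    rewrite expr0 mul1mx; apply/matrixP => i k; rewrite !mxE (ord1 k) eqxx andbT.
    by rewrite -val_eqE.
  rewrite exprS -mulmxA IH ?(ltnW jn) //; apply/matrixP => i k; rewrite !mxE.
  rewrite (bigD1 (Ordinal (ltnW jn))) //= big1 ?addr0 => [|l lj].
    by rewrite !mxE eqxx mulr1 eq_sym.
  rewrite !mxE (_ : (l == j :> nat) = false) ?mulr0 //.
  by apply: contraNF lj => /eqP E; apply/eqP/val_inj.
have -> : krylov C (delta_mx 0 0) = 1%:M; last by rewrite det1.
by apply/matrixP => j i; rewrite mxE HC ?ltn_ord // !mxE eq_sym.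
Qed.

(* Along the line from [A] to a cyclic matrix with cyclic vector [v], the Krylov
   determinant of [v] is a nonzero polynomial in the parameter. *)
Lemma cyclic_dense n (A : 'M[CC R]_n) d : (0 < n)%N -> 0 < d ->
  exists2 A', cyclic_mx A' & mx_close A' A d.
Proof.
case: n A => // n A _ d0; have [C [v dCv]] := krylov_shift n.
pose AX : 'M[{poly CC R}]_n.+1 := map_mx polyC A + 'X *: map_mx polyC (C - A).
pose KX : 'M[{poly CC R}]_n.+1 := \matrix_(j < n.+1) (AX ^+ j *m map_mx polyC v)^T.
have ev s : (\det KX).[s] = \det (krylov (A + s *: (C - A)) v).
  have AXs : map_mx (horner_eval s) AX = A + s *: (C - A).
    by apply/matrixP => i j; rewrite !mxE /horner_eval !hornerE.
  rewrite -[LHS]/(horner_eval s (\det KX)) -det_map_mx; congr (\det _).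
  apply/matrixP => j i; rewrite !mxE rmorph_sum.
  apply: eq_bigr => k _; rewrite rmorphM; congr (_ * _).
    by rewrite -AXs -rmorphXn [RHS]mxE.
  by rewrite mxE /= /horner_eval hornerC.
have KX0 : \det KX != 0.
  apply: contra_eq_neq dCv => E; have := ev 1.
  rewrite E horner0 scale1r addrC subrK => <-.
  by rewrite eq_sym oner_eq0.
pose M := \sum_i \sum_j cabs ((C - A) i j).
have M0 : 0 <= M by apply: sumr_ge0 => i _; apply: sumr_ge0 => j _; exact: cabs_ge0.
have M1 : 0 < M + 1 by lra.
have [|s [se sr]] := @small_nonroot _ (d / (M + 1)) KX0; first by rewrite divr_gt0.
exists (A + s *: (C - A)).
  by exists v; rewrite row_full_unit unitmxE unitfE -/(krylov _ _) -ev.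
move=> i j; rewrite mxE addrAC subrr add0r mxE cabsM.
have le1 : cabs ((C - A) i j) <= M.
  rewrite /M (bigD1 i) //= (bigD1 j) //= -addrA lerDl addr_ge0 //.
    by apply: sumr_ge0 => k _; exact: cabs_ge0.
  by apply: sumr_ge0 => k _; apply: sumr_ge0 => l _; exact: cabs_ge0.
move: se; rewrite ltr_pdivlMr // => se.
have s0 := cabs_ge0 s; have := ler_wpM2l s0 le1; lra.
Qed.

End Lifting.

(** * Proof of the theorem *)
Section Continuity.
Variable R : realType.

Lemma continuous_on_atP (T : topologicalType) (S : set T) (f : T -> R) x :
  continuous_on_at S f x <->
  forall e, 0 < e -> \forall y \near x, S y -> `|f y - f x| < e.
Proof.
split=> [/cvgrPdist_lt cf e e0|cf].
  have := cf e e0; rewrite near_withinE; apply: filterS => y H Sy.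
  by rewrite distrC H.
apply/cvgrPdist_lt => e e0; rewrite near_withinE.
by apply: filterS (cf e e0) => y H Sy; rewrite distrC H.
Qed.

Lemma nbhs_mx_close m n (A : 'M[CC R]_(m, n)) (P : set 'M[CC R]_(m, n)) :
  nbhs A P <-> exists2 d : R, 0 < d & forall X, mx_close X A d -> P X.
Proof.
rewrite nbhs_mxP; split=> -[d d0 HP].
  exists (d / 2) => [|X HX]; first by lra.
  by apply: HP => i j; apply: le_lt_trans (HX i j) _; lra.
by exists d => // X HX; apply: HP => i j; exact/ltW/HX.
Qed.

Lemma nbhs_pair_close n (A B : 'M[CC R]_n) (P : set ('M[CC R]_n * 'M[CC R]_n)) :
  nbhs (A, B) P <-> exists2 d : R, 0 < d &
    forall X Y, mx_close X A d -> mx_close Y B d -> P (X, Y).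
Proof.
split=> [[[U V] /= [/nbhs_mx_close[d1 d10 H1] /nbhs_mx_close[d2 d20 H2]] UVP]|[d d0 HP]].
  exists (Num.min d1 d2) => [|X Y HX HY]; first by rewrite lt_min d10.
  apply: UVP; split => /=.
    by apply: H1; apply: mx_close_le HX; rewrite ge_min lexx.
  by apply: H2; apply: mx_close_le HY; rewrite ge_min lexx orbT.
exists ([set X | mx_close X A d], [set Y | mx_close Y B d]) => /=.
  by split; apply/nbhs_mx_close; exists d.
by move=> [X Y] /= [HX HY]; exact: HP.
Qed.

Lemma sigma_close n (A : 'M[CC R]_n) (d : R) : 0 < d ->
  exists2 d', 0 < d' & forall X, mx_close X A d' -> mx_close (sigma X) (sigma A) d.
Proof.
move=> d0; have [d' d'0 H] := continuous_sigma A d0; exists (d' / 2) => [|X HX]; first by lra.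
apply/mx_close_rV => j; apply/ltW; apply: H => i k.
by apply: le_lt_trans (HX i k) _; lra.
Qed.

Lemma dist_le_of (u v e : R) : u <= v + e -> v <= u + e -> `|u - v| <= e.
Proof. by move=> ? ?; rewrite ler_norml; apply/andP; split; lra. Qed.

(** [lempert_polydisk_near] is used twice, with the nearby pair and the limit pair exchanged. *)
Lemma lempert_polydisk_sigma_near n (A B : 'M[CC R]_n) (e : R) : (0 < n)%N ->
  spectral_ball R n A -> spectral_ball R n B -> 0 < e ->
  exists2 d : R, 0 < d & forall X Y, mx_close X A d -> mx_close Y B d ->
    spectral_ball R n X -> spectral_ball R n Y ->
    `|lempert (symmetrized_polydisk R n) (sigma X) (sigma Y) -
      lempert (symmetrized_polydisk R n) (sigma A) (sigma B)| <= e.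
Proof.
move=> n0 HA HB e0.
have [d d0 Hd] := lempert_polydisk_near n0 (ex_intro2 _ _ A HA erefl)
  (ex_intro2 _ _ B HB erefl) e0.
have [dA dA0 HdA] := sigma_close A d0; have [dB dB0 HdB] := sigma_close B d0.
exists (Num.min dA dB) => [|X Y HX HY SX SY]; first by rewrite lt_min dA0.
have {}HX : mx_close (sigma X) (sigma A) d.
  by apply: HdA; apply: mx_close_le HX; rewrite ge_min lexx.
have {}HY : mx_close (sigma Y) (sigma B) d.
  by apply: HdB; apply: mx_close_le HY; rewrite ge_min lexx orbT.
have reflA : mx_close (sigma A) (sigma A) d by exact/mx_close_refl/ltW.
have reflB : mx_close (sigma B) (sigma B) d by exact/mx_close_refl/ltW.
have H1 := Hd _ _ _ _ HX HY reflA reflB (polydisk_joined n0 SX SY).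
have H2 := Hd _ _ _ _ reflA reflB HX HY (polydisk_joined n0 HA HB).
exact: dist_le_of H2 H1.
Qed.

Lemma cyclic_dense_ball n (A : 'M[CC R]_n) (d : R) : (0 < n)%N ->
  spectral_ball R n A -> 0 < d ->
  exists A', [/\ cyclic_mx A', spectral_ball R n A' & mx_close A' A d].
Proof.
move=> n0 HA d0; have [d1 d10 Hd1] := spectral_ball_open n0 HA.
have [|A' cA' HA'] := @cyclic_dense R n A (Num.min d d1) n0.
  by rewrite lt_min d0.
exists A'; split; first exact: cA'.
  by apply: Hd1; apply: mx_close_le HA'; rewrite ge_min lexx orbT.
by apply: mx_close_le HA'; rewrite ge_min lexx.
Qed.

Lemma dist_le_half (u v w e : R) :
  `|u - w| < e / 2 -> `|u - v| <= e / 2 -> `|w - v| <= e.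
Proof.
by rewrite ltr_norml !ler_norml => /andP[? ?] /andP[? ?]; apply/andP; split; lra.
Qed.

Lemma dist_lt_squeeze (u v w w' e : R) : w = w' -> 0 < e ->
  v <= w + e / 2 -> `|u - w'| <= e / 2 -> u <= v -> `|v - w| < e.
Proof.
by move=> <-; rewrite ltr_norml ler_norml => ? ? /andP[? ?] ?; apply/andP; split; lra.
Qed.

Lemma eq_of_dist_le (x y : R) : (forall e, 0 < e -> `|x - y| <= e) -> x = y.
Proof.
move=> H; apply/eqP; rewrite -subr_eq0 -normr_eq0 eq_le normr_ge0 andbT.
by apply/ler_addgt0Pr => e e0; rewrite add0r; exact: H.
Qed.

End Continuity.

Theorem proposition1p2 (R : realType) (n : nat) (hn : (0 < n)%N)
    (A B : 'M[CC R]_n)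
    (hA : spectral_ball R n A) (hB : spectral_ball R n B) :
  (continuous_on_at (spectral_ball R n `*` spectral_ball R n)
     (fun X : 'M[CC R]_n * 'M[CC R]_n => lempert (spectral_ball R n) X.1 X.2)
     (A, B)
   <-> lempert (spectral_ball R n) A B
       = lempert (symmetrized_polydisk R n) (sigma A) (sigma B))
  /\
  (cyclic_mx B ->
   continuous_on_at (spectral_ball R n)
     (fun X : 'M[CC R]_n => lempert (spectral_ball R n) X B) A ->
   lempert (spectral_ball R n) A B
   = lempert (symmetrized_polydisk R n) (sigma A) (sigma B)).
Proof.
split; [split=> [/continuous_on_atP cont|eqAB]|move=> cB /continuous_on_atP cont].
(* At a nearby cyclic pair [(X, Y)] the two Lempert functions agree; the ball value is near that at
   [(A, B)] by assumption, the polydisk value by continuity. *)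
- apply: eq_of_dist_le => e e0; have e20 : 0 < e / 2 by lra.
  have /nbhs_pair_close[d d0 Hd] := cont _ e20.
  have [d' d'0 Hd'] := lempert_polydisk_sigma_near hn hA hB e20.
  have m0 : 0 < Num.min d d' by rewrite lt_min d0.
  have [X [cX SX HX]] := cyclic_dense_ball hn hA m0.
  have [Y [cY SY HY]] := cyclic_dense_ball hn hB m0.
  have md : Num.min d d' <= d by rewrite ge_min lexx.
  have md' : Num.min d d' <= d' by rewrite ge_min lexx orbT.
  have H1 := Hd X Y (mx_close_le md HX) (mx_close_le md HY) (conj SX SY).
  have H2 := Hd' X Y (mx_close_le md' HX) (mx_close_le md' HY) SX SY.
  have {}H1 : `|lempert (symmetrized_polydisk R n) (sigma X) (sigma Y) -
      lempert (spectral_ball R n) A B| < e / 2.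
    by rewrite -(lempert_cyclic hn SX SY cX cY); exact: H1.
  exact: dist_le_half H1 H2.
(* Upper semicontinuity bounds the ball function from above. From below it dominates the polydisk
   function, which is continuous and by assumption has the same value at [(A, B)]. *)
- apply/continuous_on_atP => e e0; have e20 : 0 < e / 2 by lra.
  apply/nbhs_pair_close.
  have [d d0 Hd] := lempert_ball_usc hn hA (ball_joined hn hA hB) e20.
  have [d' d'0 Hd'] := lempert_polydisk_sigma_near hn hA hB e20.
  exists (Num.min d d') => [|X Y HX HY [SX SY]]; first by rewrite lt_min d0.
  have md : Num.min d d' <= d by rewrite ge_min lexx.
  have md' : Num.min d d' <= d' by rewrite ge_min lexx orbT.
  have H1 := Hd X Y (mx_close_le md HX) (mx_close_le md HY).
  have H2 := Hd' X Y (mx_close_le md' HX) (mx_close_le md' HY) SX SY.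
  have H3 := lempert_sigma_le hn SX SY.
  exact: dist_lt_squeeze eqAB e0 H1 H2 H3.
(* Since [B] is already cyclic, only [A] is approximated, so continuity in the first variable is
   enough. *)
- apply: eq_of_dist_le => e e0; have e20 : 0 < e / 2 by lra.
  have /nbhs_mx_close[d d0 Hd] := cont _ e20.
  have [d' d'0 Hd'] := lempert_polydisk_sigma_near hn hA hB e20.
  have m0 : 0 < Num.min d d' by rewrite lt_min d0.
  have [X [cX SX HX]] := cyclic_dense_ball hn hA m0.
  have md : Num.min d d' <= d by rewrite ge_min lexx.
  have md' : Num.min d d' <= d' by rewrite ge_min lexx orbT.
  have H1 := Hd X (mx_close_le md HX) SX.
  have H2 := Hd' X B (mx_close_le md' HX) (mx_close_refl B (ltW d'0)) SX hB.
  have {}H1 : `|lempert (symmetrized_polydisk R n) (sigma X) (sigma B) -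
      lempert (spectral_ball R n) A B| < e / 2.
    by rewrite -(lempert_cyclic hn SX hB cX cB); exact: H1.
  exact: dist_le_half H1 H2.
Qed.
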